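(* Let $(X,\Sigma,\mu)$ be a complete $\sigma$-finite measure space. Let $\Xi=(X_n)$ be an increasing sequence (with respect to inclusion) of measurable sets with positive measure such that $X=\bigcup X_n$. Let $1\le p<\infty$ and $1\le q\le\infty$ satisfy $\frac1p+\frac1q=1$. For every $n\in\mathbb{N}$, let $T_n:\mathrm{L}^q(X_n)\to\mathrm{L}^p(X_n)^\sim$ be the usual (isometric) lattice isomorphism $$T_n(u)(v)=\int_{X_n}uv\,d\mu,\quad u\in\mathrm{L}^q(X_n),\ v\in\mathrm{L}^p(X_n).$$ There exists a unique lattice isomorphism $T:\mathrm{L}^q_{\Xi-\ell oc}(X)\to\mathrm{L}^p_{\Xi-c}(X)^\sim$ such that $e_n^\sim\circ T=T_n\circ r_n$ for every $n\in\mathbb{N}$.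
   Context: $\mathrm{E}^\sim$ is the order dual of a vector lattice $\mathrm{E}$ (order bounded linear functionals), and for a positive operator $S:\mathrm{E}\to\mathrm{F}$, $S^\sim:\mathrm{F}^\sim\to\mathrm{E}^\sim$ is $\varphi\mapsto\varphi\circ S$. $\mathrm{L}^p_{\Xi-c}(X)=\{u\in\mathrm{L}^p(X): u=0 \text{ a.e. on } X\setminus X_n \text{ for some } n\in\mathbb{N}\}$, and $e_n:\mathrm{L}^p(X_n)\to\mathrm{L}^p_{\Xi-c}(X)$ is extension by $0$ outside $X_n$. $\mathrm{L}^q_{\Xi-\ell oc}(X)$ is the vector lattice of (equivalence classes of) measurable functions $u:X\to\mathbb{R}$ such that $u\mathbf{1}_{X_n}\in\mathrm{L}^q(X_n)$ for every $n\in\mathbb{N}$, and $r_n:\mathrm{L}^q_{\Xi-\ell oc}(X)\to\mathrm{L}^q(X_n)$ is restriction to $X_n$. *)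

(* Defs.v *)
From HB Require Import structures.
From mathcomp Require Import all_boot all_order all_algebra generic_quotient.
From mathcomp Require Import all_classical all_reals all_analysis.
From mathcomp Require Import measurable_realfun ess_sup_inf lra.

Set Implicit Arguments.
Unset Strict Implicit.
Unset Printing Implicit Defensive.

Import Order.TTheory GRing.Theory Num.Theory.
Import numFieldNormedType.Exports.

Local Open Scope classical_set_scope.
Local Open Scope ring_scope.
Local Open Scope quotient_scope.

(* The order and the lattice operations are fields of this mixin, and not those
   of Order.Lattice, because Hierarchy Builder does not allow a new join of
   zmodType and latticeType to be declared after realDomainType. *)
HB.mixin Record Lmodule_isVectorLattice (R : realType) V of GRing.Lmodule R V := {
  vle : V -> V -> Prop;
  vsup : V -> V -> V;
  vinf : V -> V -> V;
  vle_refl : forall x, vle x x;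
  vle_anti : forall x y, vle x y -> vle y x -> x = y;
  vle_trans : forall y x z, vle x y -> vle y z -> vle x z;
  vsupP : forall x y z, vle (vsup x y) z <-> vle x z /\ vle y z;
  vinfP : forall x y z, vle z (vinf x y) <-> vle z x /\ vle z y;
  vle_add2r : forall z x y, vle x y -> vle (x + z) (y + z);
  vle_scale : forall (a : R) x y, 0 <= a -> vle x y -> vle (a *: x) (a *: y)
}.

#[short(type="vectorLatticeType")]
HB.structure Definition VectorLattice (R : realType) :=
  { V of GRing.Lmodule R V & Lmodule_isVectorLattice R V }.

Declare Scope vlat_scope.
Delimit Scope vlat_scope with VL.
Notation "x <= y" := (vle x y) : vlat_scope.
Notation "x <= y <= z" := (vle x y /\ vle y z) : vlat_scope.
Notation "x `|` y" := (vsup x y) : vlat_scope.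
Notation "x `&` y" := (vinf x y) : vlat_scope.

Arguments vle_trans {R s} [y x z].
Arguments vle_add2r {R s} z [x y].
Arguments vle_anti {R s} [x y].
Arguments vsupP {R s} {x y z}.
Arguments vinfP {R s} {x y z}.

Section VectorLatticeTheory.
Context {R : realType} {E : vectorLatticeType R}.
Implicit Types x y z : E.

Lemma vsup_ubl x y : (x <= x `|` y)%VL.
Proof. by have /vsupP[] := vle_refl (x `|` y)%VL. Qed.

Lemma vsup_ubr x y : (y <= x `|` y)%VL.
Proof. by have /vsupP[] := vle_refl (x `|` y)%VL. Qed.

Lemma vinf_lbl x y : (x `&` y <= x)%VL.
Proof. by have /vinfP[] := vle_refl (x `&` y)%VL. Qed.

Lemma vinf_lbr x y : (x `&` y <= y)%VL.
Proof. by have /vinfP[] := vle_refl (x `&` y)%VL. Qed.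

Lemma vle_subr x y z : (x <= y - z)%VL <-> (x + z <= y)%VL.
Proof.
split; first by move=> /(vle_add2r z); rewrite subrK.
by move=> /(vle_add2r (- z)); rewrite addrK.
Qed.

Lemma vle_subl x y z : (x - z <= y)%VL <-> (x <= y + z)%VL.
Proof.
split; first by move=> /(vle_add2r z); rewrite subrK.
by move=> /(vle_add2r (- z)); rewrite addrK.
Qed.

Lemma subv_ge0 x y : (0 <= y - x)%VL <-> (x <= y)%VL.
Proof. by rewrite vle_subr add0r. Qed.

Lemma vle_add x y z t : (x <= y)%VL -> (z <= t)%VL -> (x + z <= y + t)%VL.
Proof.
move=> xy zt; apply: (vle_trans (vle_add2r z xy)).
by rewrite ![y + _]addrC; exact: vle_add2r.
Qed.

Lemma addv_ge0 x y : (0 <= x)%VL -> (0 <= y)%VL -> (0 <= x + y)%VL.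
Proof. by move=> x0 y0; rewrite -[0]addr0; exact: vle_add. Qed.

Lemma scalev_ge0 (a : R) x : 0 <= a -> (0 <= x)%VL -> (0 <= a *: x)%VL.
Proof. by move=> a0 x0; rewrite -[0](scaler0 _ a); exact: vle_scale. Qed.

Definition vpos x : E := (x `|` 0)%VL.
Definition vneg x : E := vpos x - x.

Lemma vpos_ge0 x : (0 <= vpos x)%VL. Proof. exact: vsup_ubr. Qed.
Lemma vneg_ge0 x : (0 <= vneg x)%VL.
Proof. by apply/subv_ge0; exact: vsup_ubl. Qed.
Lemma vpos_vneg x : x = vpos x - vneg x.
Proof. by rewrite /vneg opprB addrCA subrr addr0. Qed.

Lemma riesz_decomposition x y z : (0 <= x)%VL -> (0 <= y)%VL ->
    (0 <= z <= x + y)%VL ->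
  exists z1 z2 : E, [/\ (0 <= z1 <= x)%VL, (0 <= z2 <= y)%VL & z = z1 + z2].
Proof.
move=> x0 y0 [z0 zxy]; exists (z `&` x)%VL, (z - (z `&` x)%VL).
split; [split|split|by rewrite addrCA subrr addr0].
- exact/vinfP.
- exact: vinf_lbr.
- exact/subv_ge0/vinf_lbl.
- apply/vle_subl; rewrite addrC; apply/vle_subl/vinfP.
  split; apply/vle_subl => //.
  by rewrite -{1}[z]addr0; apply: vle_add => //; exact: vle_refl.
Qed.

End VectorLatticeTheory.
#[global] Hint Extern 0 (vle _ _) => exact: vle_refl : core.
#[global] Hint Extern 0 (vle _ (vpos _)) => exact: vpos_ge0 : core.
#[global] Hint Extern 0 (vle _ (vneg _)) => exact: vneg_ge0 : core.

Section Operators.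
Context {R : realType} (E F : vectorLatticeType R).

Definition positive_operator (S : E -> F) : Prop :=
  linear S /\ forall x, (0 <= x)%VL -> (0 <= S x)%VL.

Definition lattice_homomorphism (S : E -> F) : Prop :=
  [/\ linear S, {morph S : x y / (x `|` y)%VL} & {morph S : x y / (x `&` y)%VL}].

Definition lattice_isomorphism (S : E -> F) : Prop :=
  lattice_homomorphism S /\ bijective S.

End Operators.

Section SubVectorLattice.
Context (R : realType) (E : vectorLatticeType R) (P : {pred E}).
Variable U : GRing.SubLmodule.type P.
Hypothesis supP : forall x y, x \in P -> y \in P -> (x `|` y)%VL \in P.
Hypothesis infP : forall x y, x \in P -> y \in P -> (x `&` y)%VL \in P.
Implicit Types u v : U.

Let le u v : Prop := (val u <= val v)%VL.
Let sup u v : U := Sub (val u `|` val v)%VL (supP (valP u) (valP v)).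
Let inf u v : U := Sub (val u `&` val v)%VL (infP (valP u) (valP v)).

Let le_refl u : le u u. Proof. exact: vle_refl. Qed.
Let le_anti u v : le u v -> le v u -> u = v.
Proof. by move=> uv vu; exact/val_inj/vle_anti. Qed.
Let le_trans v u w : le u v -> le v w -> le u w. Proof. exact: vle_trans. Qed.
Let supE u v w : le (sup u v) w <-> le u w /\ le v w.
Proof. by rewrite /le SubK vsupP. Qed.
Let infE u v w : le w (inf u v) <-> le w u /\ le w v.
Proof. by rewrite /le SubK vinfP. Qed.
Let le_add2r w u v : le u v -> le (u + w) (v + w).
Proof. by rewrite /le !raddfD; exact: vle_add2r. Qed.
Let le_scale (a : R) u v : 0 <= a -> le u v -> le (a *: u) (a *: v).
Proof. by move=> a0; rewrite /le !linearZ; exact: vle_scale. Qed.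

Definition sub_vector_lattice : Lmodule_isVectorLattice R U :=
  Lmodule_isVectorLattice.Build R U
    le_refl le_anti le_trans supE infE le_add2r le_scale.

End SubVectorLattice.

Section OrderDual.
Context {R : realType} (E : vectorLatticeType R).
Implicit Types (x y z : E) (f g : E -> R).

Definition order_bounded_functional f : Prop :=
  forall a b : E, exists M : R, forall x, (a <= x <= b)%VL -> `|f x| <= M.

Definition order_dual_pred : {pred E -> R} :=
  [pred f | `[< scalar f /\ order_bounded_functional f >]].

Record order_dual := OrderDual {
  order_dual_fun :> E -> R;
  _ : order_dual_fun \in order_dual_pred }.

HB.instance Definition _ := [isSub of order_dual for order_dual_fun].
HB.instance Definition _ := [Choice of order_dual by <:].

Lemma order_dualP f :
  f \in order_dual_pred <-> (scalar f /\ order_bounded_functional f).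
Proof. by split=> [/asboolP|?]; last exact/asboolP. Qed.

Lemma order_dual_scalar (phi : order_dual) : scalar phi.
Proof. by have /order_dualP[] := valP phi. Qed.

Lemma order_dual_bounded (phi : order_dual) : order_bounded_functional phi.
Proof. by have /order_dualP[] := valP phi. Qed.

Lemma order_dual_submod_closed : submod_closed order_dual_pred.
Proof.
split.
  apply/order_dualP; split => [a x y|a b].
    by rewrite -[RHS]/(a * 0 + 0) mulr0 addr0.
  by exists 0 => x _; rewrite -[X in `|X|]/0 normr0.
move=> k f g /order_dualP[lf bf] /order_dualP[lg bg]; apply/order_dualP; split.
  move=> a x y; rewrite -[LHS]/(k * f (a *: x + y) + g (a *: x + y)) lf lg.
  rewrite -[RHS]/(a * (k * f x + g x) + (k * f y + g y)); lra.
move=> a b; have [M fM] := bf a b; have [N gN] := bg a b.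
exists (`|k| * M + N) => x abx.
rewrite -[X in `|X|]/(k * f x + g x).
rewrite (le_trans (ler_normD _ _))// lerD//; last exact: gN.
by rewrite normrM ler_wpM2l// fM.
Qed.

HB.instance Definition _ :=
  GRing.isSubmodClosed.Build _ _ order_dual_pred order_dual_submod_closed.
HB.instance Definition _ := [SubChoice_isSubLmodule of order_dual by <:].

End OrderDual.
Arguments order_dual_pred {R} E.

HB.instance Definition _ (R : realType) (E : vectorLatticeType R)
    (phi : order_dual E) :=
  GRing.isLinear.Build R E R *%R phi (order_dual_scalar phi).

(* The extension to E of an additive, positively homogeneous and nonnegative
   function on its positive cone. *)
Section Kantorovich.
Context {R : realType} {E : vectorLatticeType R} (p : E -> R).
Hypothesis pD : forall x y, (0 <= x)%VL -> (0 <= y)%VL -> p (x + y) = p x + p y.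
Hypothesis pZ : forall (a : R) x, 0 <= a -> (0 <= x)%VL -> p (a *: x) = a * p x.
Hypothesis p_ge0 : forall x, (0 <= x)%VL -> 0 <= p x.

Definition cone_extension x : R := p (vpos x) - p (vneg x).

Let extE u v : (0 <= u)%VL -> (0 <= v)%VL -> cone_extension (u - v) = p u - p v.
Proof.
move=> u0 v0; rewrite /cone_extension; set x := u - v.
have : p (u + vneg x) = p (v + vpos x).
  by congr p; rewrite /vneg opprB addrCA [u + _]addrCA subrr addr0 addrC.
by rewrite (pD u0 (vneg_ge0 _)) (pD v0 (vpos_ge0 _)) => h; lra.
Qed.

Lemma cone_extension_pos x : (0 <= x)%VL -> cone_extension x = p x.
Proof.
move=> x0; have p0 : p 0 = 0 by rewrite -{1}(scale0r (0 : E)) pZ ?mul0r.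
by rewrite -{1}[x]subr0 extE// p0 subr0.
Qed.

Let extD x y : cone_extension (x + y) = cone_extension x + cone_extension y.
Proof.
rewrite {1}[x]vpos_vneg {1}[y]vpos_vneg addrACA -opprD extE.
- rewrite (pD (vpos_ge0 x) (vpos_ge0 y)) (pD (vneg_ge0 x) (vneg_ge0 y)).
  by rewrite /cone_extension; lra.
- by apply: addv_ge0; exact: vpos_ge0.
- by apply: addv_ge0; exact: vneg_ge0.
Qed.

Let extZ (a : R) x : cone_extension (a *: x) = a * cone_extension x.
Proof.
have [a0|/ltW a0] := leP 0 a.
  rewrite {1}[x]vpos_vneg scalerBr extE; try exact/scalev_ge0/vpos_ge0.
    by rewrite !pZ// /cone_extension mulrBr.
  exact/scalev_ge0/vneg_ge0.
have Na0 : 0 <= - a by rewrite oppr_ge0.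
rewrite {1}[x]vpos_vneg -opprB scalerN -scaleNr scalerBr extE.
- by rewrite !pZ// /cone_extension; lra.
- exact/scalev_ge0/vneg_ge0.
- exact/scalev_ge0/vpos_ge0.
Qed.

Lemma cone_extension_dual : cone_extension \in order_dual_pred E.
Proof.
apply/order_dualP; split => [a x y|a b]; first by rewrite extD extZ.
have mono x y : (x <= y)%VL -> cone_extension x <= cone_extension y.
  move=> /subv_ge0 yx0; rewrite -[y](subrK x) extD lerDr cone_extension_pos//.
  exact: p_ge0.
exists (`|cone_extension a| + `|cone_extension b|) => x [/mono ax /mono xb].
rewrite ler_norml; apply/andP; split.
  have := ler_norm (- cone_extension a); have := normr_ge0 (cone_extension b).
  by rewrite normrN => h1 h2; lra.
by have := ler_norm (cone_extension b); have := normr_ge0 (cone_extension a) => h1 h2; lra.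
Qed.

End Kantorovich.

(* The order dual of E is a vector lattice (Riesz and Kantorovich). *)
Section OrderDualLattice.
Context {R : realType} (E : vectorLatticeType R).
Implicit Types (x y z : E) (phi psi chi : order_dual E).

Lemma order_dual_addE phi psi x : (phi + psi) x = phi x + psi x.
Proof. by []. Qed.
Lemma order_dual_oppE phi x : (- phi) x = - phi x. Proof. by []. Qed.
Lemma order_dual_0E x : (0 : order_dual E) x = 0. Proof. by []. Qed.
Lemma order_dual_scaleE (a : R) phi x : (a *: phi) x = a * phi x.
Proof. by []. Qed.
Definition order_dualE :=
  (order_dual_addE, order_dual_oppE, order_dual_0E, order_dual_scaleE).

Definition order_dual_le phi psi : Prop :=
  forall x, (0 <= x)%VL -> phi x <= psi x.

Definition pos_values phi x : set R := [set phi y | y in [set y | (0 <= y <= x)%VL]].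

Let pos_values_has_sup phi x : (0 <= x)%VL -> has_sup (pos_values phi x).
Proof.
move=> x0; split.
  by exists (phi 0), 0 => //=; split=> //; exact: vle_refl.
have [M phiM] := order_dual_bounded phi 0 x.
by exists M => _ [y /= y0x <-]; rewrite (le_trans (ler_norm _))// phiM.
Qed.

Let p phi x := sup (pos_values phi x).

Let le_p phi x y : (0 <= y <= x)%VL -> phi y <= p phi x.
Proof.
move=> [y0 yx]; apply: ub_le_sup; last by exists y.
exact: (pos_values_has_sup _ (vle_trans y0 yx)).2.
Qed.

Let p_le phi x M : (0 <= x)%VL -> (forall y, (0 <= y <= x)%VL -> phi y <= M) ->
  p phi x <= M.
Proof.
move=> x0 phiM; apply: ge_sup; first exact: (pos_values_has_sup phi x0).1.
by move=> _ [y /= /phiM + <-].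
Qed.

Let p_ge0 phi x : (0 <= x)%VL -> 0 <= p phi x.
Proof.
by move=> x0; rewrite -(raddf0 phi); apply: le_p; split=> //; exact: vle_refl.
Qed.

Let pD phi x y : (0 <= x)%VL -> (0 <= y)%VL -> p phi (x + y) = p phi x + p phi y.
Proof.
move=> x0 y0; apply/eqP; rewrite eq_le; apply/andP; split.
  apply: p_le; first exact: addv_ge0.
  move=> z z0xy.
  have [z1 [z2 [zx zy ->]]] := riesz_decomposition x0 y0 z0xy.
  by rewrite raddfD lerD// le_p.
rewrite -lerBrDr; apply: p_le => // z1 z1x.
rewrite lerBrDr -lerBrDl; apply: p_le => // z2 z2y.
rewrite lerBrDl -raddfD; apply: le_p; split.
  by apply: addv_ge0; [exact: z1x.1|exact: z2y.1].
by apply: vle_add; [exact: z1x.2|exact: z2y.2].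
Qed.

Let pZ phi (a : R) x : 0 <= a -> (0 <= x)%VL -> p phi (a *: x) = a * p phi x.
Proof.
have half b z : 0 < b -> (0 <= z)%VL -> p phi (b *: z) <= b * p phi z.
  move=> b0 z0; apply: p_le; first exact/scalev_ge0/z0/ltW.
  move=> y [y0 yz]; have -> : y = b *: (b^-1 *: y).
    by rewrite scalerA mulfV ?scale1r// gt_eqF.
  rewrite linearZ ler_pM2l//; apply: le_p; split.
    by apply: scalev_ge0 => //; rewrite invr_ge0 ltW.
  have -> : z = b^-1 *: (b *: z) by rewrite scalerA mulVf ?scale1r// gt_eqF.
  by apply: vle_scale => //; rewrite invr_ge0 ltW.
rewrite le_eqVlt => /predU1P[<- x0|a0 x0].
  rewrite scale0r mul0r; apply/eqP; rewrite eq_le p_ge0 ?andbT; last exact: vle_refl.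
  apply: p_le; first exact: vle_refl.
  by move=> y [y0 y0']; rewrite (vle_anti y0' y0) raddf0.
apply/eqP; rewrite eq_le half//= -ler_pdivlMl//.
have := half a^-1 (a *: x); rewrite scalerA mulVf ?gt_eqF// scale1r.
by apply; [rewrite invr_gt0|exact/scalev_ge0/x0/ltW].
Qed.

Definition order_dual_pos phi : order_dual E :=
  OrderDual (cone_extension_dual (@pD phi) (@pZ phi) (@p_ge0 phi)).

Lemma order_dual_posE phi x : (0 <= x)%VL ->
  order_dual_pos phi x = sup (pos_values phi x).
Proof. by move=> x0; exact: (cone_extension_pos (@pD phi) (@pZ phi)). Qed.

Definition order_dual_sup phi psi : order_dual E := psi + order_dual_pos (phi - psi).
Definition order_dual_inf phi psi : order_dual E := phi - order_dual_pos (phi - psi).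

Let dle_refl phi : order_dual_le phi phi. Proof. by []. Qed.

Let dle_anti phi psi : order_dual_le phi psi -> order_dual_le psi phi -> phi = psi.
Proof.
move=> h1 h2; apply/val_inj/funext => x.
have lin chi : chi x = chi (vpos x) - chi (vneg x).
  by rewrite {1}[x]vpos_vneg raddfB.
have pos z : (0 <= z)%VL -> phi z = psi z.
  by move=> z0; apply/eqP; rewrite eq_le h1 ?h2.
by rewrite -[LHS]/(phi x) -[RHS]/(psi x) (lin phi) (lin psi) !pos.
Qed.

Let dle_trans psi phi chi :
  order_dual_le phi psi -> order_dual_le psi chi -> order_dual_le phi chi.
Proof. by move=> h1 h2 x x0; rewrite (le_trans (h1 x x0))// h2. Qed.

Let posP phi chi : order_dual_le (order_dual_pos phi) chi <->
  order_dual_le phi chi /\ order_dual_le 0 chi.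
Proof.
split=> [h|[h1 h2] x x0].
  split=> x x0; apply: le_trans (h x x0); rewrite order_dual_posE//.
  - by apply: le_p; split=> //; exact: vle_refl.
  - exact: p_ge0.
rewrite order_dual_posE//; apply: p_le => // y [y0 yx].
rewrite (le_trans (h1 _ y0))// -[x](subrK y) raddfD lerDr.
by apply: h2; apply/subv_ge0.
Qed.

Let supE phi psi chi : order_dual_le (order_dual_sup phi psi) chi <->
  order_dual_le phi chi /\ order_dual_le psi chi.
Proof.
have -> : order_dual_le (order_dual_sup phi psi) chi <->
    order_dual_le (order_dual_pos (phi - psi)) (chi - psi).
  by split=> h x /h; rewrite !order_dualE => *; lra.
by rewrite posP; split=> -[h1 h2]; split=> x x0; move: (h1 x x0) (h2 x x0);
  rewrite !order_dualE => *; lra.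
Qed.

Let infE phi psi chi : order_dual_le chi (order_dual_inf phi psi) <->
  order_dual_le chi phi /\ order_dual_le chi psi.
Proof.
have -> : order_dual_le chi (order_dual_inf phi psi) <->
    order_dual_le (order_dual_pos (phi - psi)) (phi - chi).
  by split=> h x /h; rewrite !order_dualE => *; lra.
by rewrite posP; split=> -[h1 h2]; split=> x x0; move: (h1 x x0) (h2 x x0);
  rewrite !order_dualE => *; lra.
Qed.

Let dle_add2r chi phi psi :
  order_dual_le phi psi -> order_dual_le (phi + chi) (psi + chi).
Proof. by move=> h x /h; rewrite !order_dualE lerD2r. Qed.

Let dle_scale (a : R) phi psi :
  0 <= a -> order_dual_le phi psi -> order_dual_le (a *: phi) (a *: psi).
Proof. by move=> a0 h x /h; rewrite !order_dualE; exact: ler_wpM2l. Qed.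

HB.instance Definition _ := Lmodule_isVectorLattice.Build R (order_dual E)
  dle_refl dle_anti dle_trans supE infE dle_add2r dle_scale.

End OrderDualLattice.

Lemma order_adjoint_subproof (R : realType) (E F : vectorLatticeType R)
    (S : E -> F) (S_pos : positive_operator S) (phi : order_dual F) :
  phi \o S \in order_dual_pred E.
Proof.
have [lS S0] := S_pos; apply/order_dualP; split=> [a x y|a b].
  by rewrite /= lS linearP.
have [M phiM] := order_dual_bounded phi (S a) (S b).
have mono x y : (x <= y)%VL -> (S x <= S y)%VL.
  move=> /subv_ge0 /S0; rewrite -scaleN1r addrC lS scaleN1r addrC.
  by move/subv_ge0.
by exists M => x [ax xb]; apply: phiM; split; exact: mono.
Qed.

Definition order_adjoint (R : realType) (E F : vectorLatticeType R)
    (S : E -> F) (S_pos : positive_operator S) (phi : order_dual F) :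
  order_dual E := OrderDual (order_adjoint_subproof S_pos phi).

(* The vector lattice of measurable functions up to equality mu-almost
   everywhere, with the order "less than or equal mu-almost everywhere". *)
Section L0.
Context {d} {T : measurableType d} {R : realType} {mu : {measure set T -> \bar R}}.
Local Notation L0 := {mfun_ mu, T >-> measurableTypeR R}.
Implicit Types (u v w : L0) (f g h : T -> R).

Lemma measurable_L0 u : measurable_fun [set: T] (u : T -> R).
Proof. exact: (@measurable_funPT _ _ T (measurableTypeR R) (repr u)). Qed.

Definition ae_class f (mf : measurable_fun [set: T] f) : L0 :=
  \pi_(L0) (@mfun_Sub _ _ T (measurableTypeR R) f (mem_set mf)).

Lemma ae_classE f (mf : measurable_fun [set: T] f) :
  \forall x \ae mu, ae_class mf x = f x.
Proof.
have : repr (ae_class mf) =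
    @mfun_Sub _ _ T (measurableTypeR R) f (mem_set mf) %[mod L0].
  by rewrite reprK.
by move=> /eqmodP/asboolP; apply: filterS => x /(_ I).
Qed.

Lemma L0P u v : (\forall x \ae mu, u x = v x) -> u = v.
Proof.
move=> uv; rewrite -[u]reprK -[v]reprK; apply/eqmodP/asboolP.
by apply: filterS uv => x.
Qed.

Lemma ae_class_eq f g (mf : measurable_fun [set: T] f)
  (mg : measurable_fun [set: T] g) : f =1 g -> ae_class mf = ae_class mg.
Proof.
move=> fg; apply: L0P.
by apply: filterS2 (ae_classE mf) (ae_classE mg) => x -> ->.
Qed.

Lemma ae_classK u : ae_class (measurable_L0 u) = u.
Proof. by apply: L0P; exact: ae_classE. Qed.

Definition L0_zero : L0 := ae_class (measurable_cst (0 : R)).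
Definition L0_add u v : L0 :=
  ae_class (measurable_funD (measurable_L0 u) (measurable_L0 v)).
Definition L0_scale (a : R) u : L0 :=
  ae_class (measurable_funM (measurable_cst a) (measurable_L0 u)).
Definition L0_opp u : L0 := L0_scale (-1) u.
Definition L0_le u v : Prop := \forall x \ae mu, u x <= v x.
Definition L0_sup u v : L0 :=
  ae_class (measurable_maxr (measurable_L0 u) (measurable_L0 v)).
Definition L0_inf u v : L0 :=
  ae_class (measurable_minr (measurable_L0 u) (measurable_L0 v)).


Let L0_addE u v : \forall x \ae mu, L0_add u v x = u x + v x.
Proof. exact: ae_classE. Qed.
Let L0_scaleE a u : \forall x \ae mu, L0_scale a u x = a * u x.
Proof. exact: ae_classE. Qed.
Let L0_zeroE : \forall x \ae mu, L0_zero x = 0 :> R.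
Proof. exact: ae_classE. Qed.
Let L0_supE u v : \forall x \ae mu, L0_sup u v x = Num.max (u x) (v x) :> R.
Proof. exact: ae_classE. Qed.
Let L0_infE u v : \forall x \ae mu, L0_inf u v x = Num.min (u x) (v x) :> R.
Proof. exact: ae_classE. Qed.

Let L0_addA : associative (@L0_add).
Proof.
move=> u v w; apply: L0P; near=> x.
rewrite (near (L0_addE u (L0_add v w)) x)// (near (L0_addE v w) x)//.
rewrite (near (L0_addE (L0_add u v) w) x)// (near (L0_addE u v) x)//.
exact: addrA.
Unshelve. all: by end_near. Qed.

Let L0_addC : commutative (@L0_add).
Proof.
move=> u v; apply: L0P; apply: filterS2 (L0_addE u v) (L0_addE v u) => x -> ->.
exact: addrC.
Qed.

Let L0_add0 : left_id L0_zero L0_add.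
Proof.
move=> u; apply: L0P; apply: filterS2 (L0_addE L0_zero u) L0_zeroE => x -> ->.
exact: add0r.
Qed.

Let L0_addN : left_inverse L0_zero L0_opp L0_add.
Proof.
move=> u; apply: L0P.
apply: filterS3 (L0_addE (L0_opp u) u) L0_zeroE (L0_scaleE (-1) u) => x -> -> ->.
by rewrite mulN1r; exact: addNr.
Qed.

HB.instance Definition _ :=
  GRing.isZmodule.Build L0 L0_addA L0_addC L0_add0 L0_addN.

Let L0_scaleA (a b : R) u : L0_scale a (L0_scale b u) = L0_scale (a * b) u.
Proof.
apply: L0P.
apply: filterS3 (L0_scaleE a (L0_scale b u)) (L0_scaleE b u)
  (L0_scaleE (a * b) u) => x -> -> ->.
exact: mulrA.
Qed.

Let L0_scale1 : left_id 1 L0_scale.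
Proof.
by move=> u; apply: L0P; apply: filterS (L0_scaleE 1 u) => x ->; rewrite mul1r.
Qed.

Let L0_scaleDr : right_distributive L0_scale +%R.
Proof.
move=> a u v; apply: L0P; near=> x.
rewrite (near (L0_scaleE a (u + v)) x)// (near (L0_addE u v) x)//.
rewrite (near (L0_addE (L0_scale a u) (L0_scale a v)) x)//.
rewrite (near (L0_scaleE a u) x)// (near (L0_scaleE a v) x)//.
exact: mulrDr.
Unshelve. all: by end_near. Qed.

Let L0_scaleDl u : {morph L0_scale^~ u : a b / a + b}.
Proof.
move=> a b; apply: L0P; near=> x.
rewrite (near (L0_scaleE (a + b) u) x)//.
rewrite (near (L0_addE (L0_scale a u) (L0_scale b u)) x)//.
rewrite (near (L0_scaleE a u) x)// (near (L0_scaleE b u) x)//.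
exact: mulrDl.
Unshelve. all: by end_near. Qed.

HB.instance Definition _ := GRing.Zmodule_isLmodule.Build R L0
  L0_scaleA L0_scale1 L0_scaleDr L0_scaleDl.

Lemma ae_addE u v : \forall x \ae mu, (u + v : L0) x = u x + v x.
Proof. exact: L0_addE. Qed.
Lemma ae_scaleE (a : R) u : \forall x \ae mu, (a *: u : L0) x = a * u x.
Proof. exact: L0_scaleE. Qed.
Lemma ae_zeroE : \forall x \ae mu, (0 : L0) x = 0 :> R.
Proof. exact: L0_zeroE. Qed.

Let le_refl u : L0_le u u. Proof. exact: aeW. Qed.

Let le_anti u v : L0_le u v -> L0_le v u -> u = v.
Proof.
by move=> uv vu; apply: L0P; apply: filterS2 uv vu => x xy yx; apply/eqP;
  rewrite eq_le xy.
Qed.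

Let le_trans v u w : L0_le u v -> L0_le v w -> L0_le u w.
Proof. by apply: filterS2 => x; exact: le_trans. Qed.

Let supP u v w : L0_le (L0_sup u v) w <-> L0_le u w /\ L0_le v w.
Proof.
split=> [h|[uw vw]]; first split.
- by apply: filterS2 (L0_supE u v) h => x ->; rewrite ge_max => /andP[].
- by apply: filterS2 (L0_supE u v) h => x ->; rewrite ge_max => /andP[].
- by apply: filterS3 (L0_supE u v) uw vw => x -> + +; rewrite ge_max => -> ->.
Qed.

Let infP u v w : L0_le w (L0_inf u v) <-> L0_le w u /\ L0_le w v.
Proof.
split=> [h|[wu wv]]; first split.
- by apply: filterS2 (L0_infE u v) h => x ->; rewrite le_min => /andP[].
- by apply: filterS2 (L0_infE u v) h => x ->; rewrite le_min => /andP[].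
- by apply: filterS3 (L0_infE u v) wu wv => x -> + +; rewrite le_min => -> ->.
Qed.

Let le_add2r w u v : L0_le u v -> L0_le (u + w) (v + w).
Proof.
move=> uv; apply: filterS3 (ae_addE u w) (ae_addE v w) uv => x -> -> uv.
by rewrite lerD2r.
Qed.

Let le_scale (a : R) u v : 0 <= a -> L0_le u v -> L0_le (a *: u) (a *: v).
Proof.
move=> a0 uv; apply: filterS3 (ae_scaleE a u) (ae_scaleE a v) uv => x -> -> uv.
exact: ler_wpM2l.
Qed.

HB.instance Definition _ := Lmodule_isVectorLattice.Build R L0
  le_refl le_anti le_trans supP infP le_add2r le_scale.

Lemma ae_supE u v : \forall x \ae mu, ((u `|` v)%VL : L0) x = Num.max (u x) (v x) :> R.
Proof. exact: L0_supE. Qed.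
Lemma ae_infE u v : \forall x \ae mu, ((u `&` v)%VL : L0) x = Num.min (u x) (v x) :> R.
Proof. exact: L0_infE. Qed.
Lemma ae_leP u v : (u <= v)%VL <-> \forall x \ae mu, u x <= v x.
Proof. by []. Qed.

End L0.

Section FiniteNorm.
Context d (T : measurableType d) (R : realType) (mu : {measure set T -> \bar R}).
Context (p : \bar R) (p1 : (1 <= p)%E).
Local Notation L0 := {mfun_ mu, T >-> measurableTypeR R}.
Implicit Types f g : T -> R.

Lemma finite_norm_le f g : measurable_fun [set: T] f -> measurable_fun [set: T] g ->
  (\forall x \ae mu, `|f x| <= `|g x|) -> finite_norm mu p g -> finite_norm mu p f.
Proof.
move=> mf mg fg; apply: le_lt_trans.
rewrite unlock /Lnorm; case: p p1 => [r|_|//].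
  rewrite lee_fin => r1; have r0 : 0 <= r by exact: le_trans r1.
  apply: gt0_ler_poweR.
  - by rewrite invr_ge0.
  - by rewrite in_itv/= leey integral_ge0// => x _; exact: poweR_ge0.
  - by rewrite in_itv/= leey integral_ge0// => x _; exact: poweR_ge0.
  have mpow (h : T -> R) : measurable_fun [set: T] h -> measurable_fun [set: T]
      (fun x => `|(EFin \o h) x| `^ r)%E.
    move=> mh; apply: (measurableT_comp (measurable_poweR _)) => //.
    by apply: measurableT_comp => //; exact/measurable_EFinP.
  apply: ae_ge0_le_integral => //; try exact: mpow.
  - by move=> x _; exact: poweR_ge0.
  - by move=> x _; exact: poweR_ge0.
  by apply: filterS fg => x fg _; rewrite /= lee_fin ge0_ler_powR ?nnegrE.
case: ifPn => // mu0; apply: le_ess_sup.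
by apply: filterS fg => x fg; rewrite /= lee_fin.
Qed.

Lemma finite_norm_add f g : measurable_fun [set: T] f -> measurable_fun [set: T] g ->
  finite_norm mu p f -> finite_norm mu p g -> finite_norm mu p (f \+ g).
Proof.
move=> mf mg ff fg; by apply: (le_lt_trans (@eminkowski _ _ _ mu f g p _ _ _)) => //;
  exact: lte_add_pinfty.
Qed.

Lemma finite_norm_scale a f : measurable_fun [set: T] f ->
  finite_norm mu p f -> finite_norm mu p (fun x => a * f x).
Proof.
move=> mf ff.
have fL : f \in Lfun mu p by apply/andP; rewrite !inE.
have := (Lfun_submod_closed mu p1).2 a f 0 fL (Lfun_submod_closed mu p1).1.
by rewrite addr0 => /andP[_]; rewrite inE.
Qed.

End FiniteNorm.

(* LspaceType comes without algebraic structure: it is made here into a vector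
   sublattice of the space of classes of measurable functions. *)
Section Lspace.
Context d (T : measurableType d) (R : realType) (mu : {measure set T -> \bar R}).
Context (p : \bar R) (p1 : (1 <= p)%E).
Local Notation L0 := {mfun_ mu, T >-> measurableTypeR R}.
Local Notation Lp := (LspaceType mu p1).
Implicit Types (u v w : L0) (f g : T -> R).

Definition Lspace_pred : {pred L0} := [pred u : L0 | finite_norm mu p u].

Lemma finite_norm_ae_class (f : T -> R) (mf : measurable_fun [set: T] f) :
  finite_norm mu p f -> finite_norm mu p (ae_class mf : L0).
Proof.
apply: finite_norm_le => //; first exact: measurable_L0.
by apply: filterS (ae_classE mf) => x ->.
Qed.

Definition Lspace_Sub u (Pu : u \in Lspace_pred) : Lp :=
  LebesgueSpace.Pack (LebesgueSpace.Class (isFinLebesgue.Build _ _ _ mu _ p1 u Pu)).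

Lemma Lspace_rect (K : Lp -> Type) :
  (forall u (Pu : u \in Lspace_pred), K (Lspace_Sub Pu)) -> forall w : Lp, K w.
Proof. by move=> Ksub [u [[Pu]]]; exact: Ksub. Qed.

Lemma Lspace_SubK u (Pu : u \in Lspace_pred) : (Lspace_Sub Pu : L0) = u.
Proof. by []. Qed.

HB.instance Definition _ := isSub.Build _ _ Lp Lspace_rect Lspace_SubK.
HB.instance Definition _ := [Choice of Lp by <:].

Lemma Lspace_finite_norm (u : Lp) : finite_norm mu p (u : L0).
Proof. exact: (valP u). Qed.

Lemma Lspace_submod_closed : submod_closed Lspace_pred.
Proof.
split.
  rewrite inE; apply: finite_norm_ae_class => //; exact: finite_norm_cst0.
move=> a u v; rewrite !inE => fu fv.
have mau : measurable_fun [set: T] (fun x => a * (u : L0) x).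
  by apply: measurable_funM => //; exact: measurable_L0.
apply: (finite_norm_le p1 _ _ _ (finite_norm_add p1 _ _
  (finite_norm_scale p1 a _ fu) fv)) => //; try exact: measurable_L0.
  by apply: measurable_funD => //; exact: measurable_L0.
by apply: filterS2 (ae_addE (a *: u) v) (ae_scaleE a u) => x -> ->.
Qed.

HB.instance Definition _ :=
  GRing.isSubmodClosed.Build _ _ Lspace_pred Lspace_submod_closed.
HB.instance Definition _ := [SubChoice_isSubLmodule of Lp by <:].

Let normM f g : measurable_fun [set: T] f -> measurable_fun [set: T] g ->
  finite_norm mu p f -> finite_norm mu p g ->
  finite_norm mu p (fun x => `|f x| + `|g x|).
Proof.
move=> mf mg ff fg.
have mn (h : T -> R) : measurable_fun [set: T] h -> measurable_fun [set: T] (fun x => `|h x|).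
  exact: measurableT_comp.
apply: (finite_norm_add p1); [exact: mn|exact: mn| |].
  by apply: (finite_norm_le p1 (mn _ mf) mf _ ff); apply: aeW => x; rewrite normr_id.
by apply: (finite_norm_le p1 (mn _ mg) mg _ fg); apply: aeW => x; rewrite normr_id.
Qed.

Let bound u v w : u \in Lspace_pred -> v \in Lspace_pred ->
  (\forall x \ae mu, `|w x| <= `|u x| + `|v x|) -> w \in Lspace_pred.
Proof.
rewrite !inE => fu fv wuv.
apply: (finite_norm_le p1 _ _ _ (normM _ _ fu fv)); try exact: measurable_L0.
  by apply: measurable_funD; apply: measurableT_comp => //; exact: measurable_L0.
by apply: filterS wuv => x; rewrite [X in _ -> _ <= X]ger0_norm// addr_ge0.
Qed.

Lemma Lspace_sup_closed u v : u \in Lspace_pred -> v \in Lspace_pred ->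
  (u `|` v)%VL \in Lspace_pred.
Proof.
move=> fu fv; apply: (bound fu fv); apply: filterS (ae_supE u v) => x ->.
by case: (leP (u x : R) (v x : R)) => _; [rewrite lerDr|rewrite lerDl].
Qed.

Lemma Lspace_inf_closed u v : u \in Lspace_pred -> v \in Lspace_pred ->
  (u `&` v)%VL \in Lspace_pred.
Proof.
move=> fu fv; apply: (bound fu fv); apply: filterS (ae_infE u v) => x ->.
by case: (leP (u x : R) (v x : R)) => _; [rewrite lerDl|rewrite lerDr].
Qed.

HB.instance Definition _ : Lmodule_isVectorLattice R Lp :=
  sub_vector_lattice Lp Lspace_sup_closed Lspace_inf_closed.

End Lspace.
Arguments Lspace_pred {d T R} mu p.

Section Hoelder.
Context d (T : measurableType d) (R : realType) (mu : {measure set T -> \bar R}).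
Implicit Types f g : T -> R.

Lemma finite_norm_oo f : measurable_fun [set: T] f ->
  finite_norm mu +oo%E f <-> exists M, \forall x \ae mu, `|f x| <= M.
Proof.
move=> mf; rewrite /finite_norm unlock; case: ifPn => mu0; split=> //.
- by move=> /ess_supr_bounded.
- move=> [M fM]; apply: (@le_lt_trans _ _ M%:E); last exact: ltry.
  by apply/ess_supP; apply: filterS fM => x; rewrite /= lee_fin.
- move=> _; exists 0; exists [set: T]; split=> //.
  by apply/eqP; rewrite eq_le measure_ge0 andbT leNgt.
Qed.

Lemma conjugate_integrable (p q : \bar R) f g :
    (1 <= p)%E -> (1 <= q)%E -> (p^-1 + q^-1 = 1)%E ->
    measurable_fun [set: T] f -> measurable_fun [set: T] g ->
    finite_norm mu p f -> finite_norm mu q g ->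
  mu.-integrable [set: T] (EFin \o (f \* g)).
Proof.
move=> p1 q1 pq mf mg ff fg; apply/Lfun1_integrable/andP; rewrite !inE.
have mfg : measurable_fun [set: T] (f \* g) by exact: measurable_funM.
split=> //=.
have sym (h k : T -> R) : measurable_fun [set: T] h -> measurable_fun [set: T] k ->
    finite_norm mu 1%:E h -> finite_norm mu +oo%E k -> finite_norm mu 1 (h \* k).
  move=> mh mk fh /(finite_norm_oo mk)[M kM].
  have mMh : measurable_fun [set: T] (fun x => M * h x) by exact: measurable_funM.
  apply: (finite_norm_le _ _ mMh _ (finite_norm_scale _ M mh fh)) => //.
    exact: measurable_funM.
  apply: filterS kM => x kM; rewrite /= !normrM mulrC ler_wpM2r//.
  exact: le_trans (ler_norm _).
move: p q p1 q1 pq ff fg => [r| |] [s| |]//.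
- rewrite !lee_fin => r1 s1.
  have r0 : 0 < r by exact: lt_le_trans r1.
  have s0 : 0 < s by exact: lt_le_trans s1.
  rewrite !inver !gt_eqF// -EFinD => -[rs] ff fg.
  apply: (le_lt_trans (hoelder mu mf mg r0 s0 rs)).
  by rewrite lte_mul_pinfty// ?ge0_fin_numE ?Lnorm_ge0.
- move=> _ _; rewrite invey adde0 => /eqP; rewrite inve_eq1 => /eqP ->.
  exact: sym.
- move=> _ _; rewrite invey add0e => /eqP; rewrite inve_eq1 => /eqP -> foo f1.
  rewrite (_ : f \* g = g \* f); first exact: sym.
  by apply/funext => x /=; rewrite mulrC.
- by move=> _ _; rewrite invey adde0 => /eqP; rewrite lt_eqF.
Qed.

End Hoelder.

Section Restriction.
Context d (T : measurableType d) (R : realType) (mu : {measure set T -> \bar R}).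
Context (D : set T) (mD : measurable D).
Local Notation muD := (mrestr mu mD).
Implicit Types f g : T -> R.

Lemma ae_mrestr (P : T -> Prop) :
  (\forall x \ae muD, P x) <-> (\forall x \ae mu, D x -> P x).
Proof.
split=> -[A [mA A0 PA]].
  exists (A `&` D); split=> //; first exact: measurableI.
  by move=> x /= /not_implyP[Dx Px]; split => //; exact: PA.
exists (A `|` ~` D); split.
- by apply: measurableU => //; exact: measurableC.
- apply/eqP; rewrite eq_le measure_ge0 andbT -A0 /mrestr setIUl setICl setU0.
  by apply: le_measure; rewrite ?inE//; exact: measurableI.
- move=> x /= Px; have [Dx|] := pselect (D x); last by right.
  by left; apply: PA => /= /(_ Dx).
Qed.

Lemma integrable_mrestr f : muD.-integrable [set: T] (EFin \o f) ->
  mu.-integrable D (EFin \o f).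
Proof.
move=> /(integrableS measurableT mD (@subsetT _ _))/integrableP[mf foo].
apply/integrableP; split=> //.
rewrite (eq_measure_integral muD)// => A mA AD.
by rewrite /= /mrestr setIidl.
Qed.

Lemma finite_norm_extension (p : \bar R) f : (1 <= p)%E ->
  measurable_fun [set: T] f -> finite_norm muD p f ->
  finite_norm mu p (f \* \1_D).
Proof.
move=> p1 mf.
have mfD : measurable_fun [set: T] (f \* \1_D).
  by apply: measurable_funM => //; exact: measurable_indic.
move: p p1 => [r| |]// => [|_].
  rewrite lee_fin => r1; have r0 : 0 < r by exact: lt_le_trans r1.
  apply: le_lt_trans; rewrite unlock.
  apply: gt0_ler_poweR.
  - by rewrite invr_ge0 ltW.
  - by rewrite in_itv/= leey integral_ge0// => x _; exact: poweR_ge0.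
  - by rewrite in_itv/= leey integral_ge0// => x _; exact: poweR_ge0.
  have mpow : measurable_fun [set: T] (fun x => `|(EFin \o f) x| `^ r)%E.
    apply: (measurableT_comp (measurable_poweR _)) => //.
    by apply: measurableT_comp => //; exact/measurable_EFinP.
  rewrite (_ : (fun x => _) = (fun x => `|(EFin \o f) x| `^ r)%E \_ D); last first.
    apply/funext => x; rewrite /patch/= indicE.
    by case: (x \in D); rewrite ?mulr1// mulr0 normr0 powR0// gt_eqF.
  rewrite -integral_mkcond (eq_measure_integral muD).
    by apply: ge0_subset_integral => // x _; exact: poweR_ge0.
  by move=> A mA AD; rewrite /= /mrestr setIidl.
move=> /(finite_norm_oo _ mf)[M /ae_mrestr fM].
apply/(finite_norm_oo _ mfD); exists (`|M|).
apply: filterS fM => x fM; rewrite /= normrM indicE.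
case: (boolP (x \in D)); rewrite ?inE => Dx; last by rewrite normr0 mulr0.
by rewrite normr1 mulr1 (le_trans (fM _))// ?ler_norm// -in_setE.
Qed.

End Restriction.

(* The conditions on the sequence are bundled with it because the spaces below
   depend on them: Lspace_c is a subspace because the sequence is increasing. *)
Record exhaustion d (T : measurableType d) (R : realType)
    (mu : {measure set T -> \bar R}) := Exhaustion {
  exhaustion_set :> nat -> set T;
  exhaustion_measurable : forall n, measurable (exhaustion_set n);
  exhaustion_increasing :
    forall m n, (m <= n)%N -> exhaustion_set m `<=` exhaustion_set n;
  exhaustion_gt0 : forall n, (0 < mu (exhaustion_set n))%E;
  exhaustion_cover : \bigcup_n exhaustion_set n = [set: T]
}.

Section Spaces.
Context d (T : measurableType d) (R : realType) (mu : {measure set T -> \bar R}).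
Variable Xi : exhaustion mu.
Local Notation L0 := {mfun_ mu, T >-> measurableTypeR R}.

(* L^p(X_n) is the L^p-space of the restriction of mu to X_n: its elements are
   functions on T taken up to equality almost everywhere on X_n. *)
Definition piece n : {measure set T -> \bar R} :=
  mrestr mu (exhaustion_measurable Xi n).

Section CompactSupport.
Context (p : \bar R) (p1 : (1 <= p)%E).

Definition Lspace_c_pred : {pred LspaceType mu p1} :=
  [pred u : LspaceType mu p1 |
    `[< exists n, \forall x \ae mu, ~ Xi n x -> u x = 0 :> R >] ].

Record Lspace_c := LspaceC {
  Lspace_c_val :> LspaceType mu p1;
  _ : Lspace_c_val \in Lspace_c_pred }.

HB.instance Definition _ := [isSub of Lspace_c for Lspace_c_val].
HB.instance Definition _ := [Choice of Lspace_c by <:].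

Let bound (u v w : LspaceType mu p1) :
  u \in Lspace_c_pred -> v \in Lspace_c_pred ->
  (\forall x \ae mu, u x = 0 :> R -> v x = 0 :> R -> w x = 0 :> R) ->
  w \in Lspace_c_pred.
Proof.
move=> /asboolP[m um] /asboolP[n vn] uvw; apply/asboolP; exists (maxn m n).
apply: filterS3 um vn uvw => x um vn uvw Xx; apply: uvw.
  by apply: um; apply: contra_not Xx; apply: exhaustion_increasing; exact: leq_maxl.
by apply: vn; apply: contra_not Xx; apply: exhaustion_increasing; exact: leq_maxr.
Qed.

Lemma Lspace_c_submod_closed : submod_closed Lspace_c_pred.
Proof.
split; first by apply/asboolP; exists 0; apply: filterS (ae_zeroE (mu := mu)).
move=> a u v cu cv; apply: (bound cu cv).
apply: filterS2 (ae_addE (a *: (u : L0)) v) (ae_scaleE a (u : L0)).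
by move=> x /= -> -> -> ->; rewrite mulr0 addr0.
Qed.

HB.instance Definition _ :=
  GRing.isSubmodClosed.Build _ _ Lspace_c_pred Lspace_c_submod_closed.
HB.instance Definition _ := [SubChoice_isSubLmodule of Lspace_c by <:].

Lemma Lspace_c_sup_closed u v : u \in Lspace_c_pred -> v \in Lspace_c_pred ->
  (u `|` v)%VL \in Lspace_c_pred.
Proof.
move=> cu cv; apply: (bound cu cv).
by apply: filterS (ae_supE (u : L0) (v : L0)) => x /= -> -> ->; rewrite maxxx.
Qed.

Lemma Lspace_c_inf_closed u v : u \in Lspace_c_pred -> v \in Lspace_c_pred ->
  (u `&` v)%VL \in Lspace_c_pred.
Proof.
move=> cu cv; apply: (bound cu cv).
by apply: filterS (ae_infE (u : L0) (v : L0)) => x /= -> -> ->; rewrite minxx.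
Qed.

HB.instance Definition _ : Lmodule_isVectorLattice R Lspace_c :=
  sub_vector_lattice Lspace_c Lspace_c_sup_closed Lspace_c_inf_closed.

End CompactSupport.

Section Local.
Context (q : \bar R) (q1 : (1 <= q)%E).
Implicit Types u v w : L0.

(* The unused argument only gives the type Lspace_loc access to a proof of
   1 <= q, without which Lspace_loc_pred would not be known to be a subspace. *)
Definition Lspace_loc_pred of (1 <= q)%E : {pred L0} :=
  [pred u : L0 | `[< forall n, finite_norm (piece n) q (u \* \1_(Xi n)) >] ].

Record Lspace_loc := LspaceLoc {
  Lspace_loc_val :> L0;
  _ : Lspace_loc_val \in Lspace_loc_pred q1 }.

HB.instance Definition _ := [isSub of Lspace_loc for Lspace_loc_val].
HB.instance Definition _ := [Choice of Lspace_loc by <:].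

Lemma Lspace_locP u : u \in Lspace_loc_pred q1 <->
  forall n, finite_norm (piece n) q u.
Proof.
have muX n : measurable_fun [set: T] (u \* \1_(Xi n)).
  apply: measurable_funM; first exact: measurable_L0.
  exact/measurable_indic/exhaustion_measurable.
have eqX n : \forall x \ae piece n, (u \* \1_(Xi n)) x = u x :> R.
  by apply/ae_mrestr/aeW => x Xx; rewrite /= indicE mem_set// mulr1.
split=> [/asboolP h n|h]; last apply/asboolP => n.
  apply: (finite_norm_le q1 (measurable_L0 u) (muX n) _ (h n)).
  by apply: filterS (eqX n) => x ->.
apply: (finite_norm_le q1 (muX n) (measurable_L0 u) _ (h n)).
by apply: filterS (eqX n) => x ->.
Qed.

Let ae_piece n (P : T -> Prop) :
  (\forall x \ae mu, P x) -> \forall x \ae piece n, P x.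
Proof. by move=> mP; apply/ae_mrestr; apply: filterS mP. Qed.

Let bound u v w : u \in Lspace_loc_pred q1 -> v \in Lspace_loc_pred q1 ->
  (\forall x \ae mu, `|w x : R| <= `|u x : R| + `|v x : R|) ->
  w \in Lspace_loc_pred q1.
Proof.
move=> /Lspace_locP lu /Lspace_locP lv wuv; apply/Lspace_locP => n.
have mn (z : L0) : measurable_fun [set: T] (fun x => `|(z : L0) x : R|).
  by apply: measurableT_comp => //; exact: measurable_L0.
have fn (z : L0) : finite_norm (piece n) q z -> finite_norm (piece n) q (fun x => `|(z : L0) x : R|).
  apply: (finite_norm_le q1 (mn z) (measurable_L0 z)).
  by apply: aeW => x; rewrite normr_id.
apply: (finite_norm_le q1 _ _ _ (finite_norm_add q1 (mn u) (mn v) (fn _ (lu n)) (fn _ (lv n)))).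
- exact: measurable_L0.
- exact: measurable_funD.
- apply: ae_piece; apply: filterS wuv => x.
  by rewrite [X in _ -> _ <= X]ger0_norm// addr_ge0.
Qed.

Lemma Lspace_loc_submod_closed : submod_closed (Lspace_loc_pred q1).
Proof.
split.
  apply/Lspace_locP => n.
  apply: (finite_norm_le q1 (measurable_L0 _) (measurable_cst (0 : R))).
    by apply: ae_piece; apply: filterS (ae_zeroE (mu := mu)) => x ->.
  exact: finite_norm_cst0.
move=> a u v lu lv.
apply: (@bound (a *: u : L0) v) => //.
  apply/Lspace_locP => n; move/Lspace_locP/(_ n) : lu => lu.
  have mau : measurable_fun [set: T] (fun x => a * (u : L0) x).
    by apply: measurable_funM => //; exact: measurable_L0.
  apply: (finite_norm_le q1 (measurable_L0 _) mau _
    (finite_norm_scale q1 a (measurable_L0 u) lu)).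
  by apply: ae_piece; apply: filterS (ae_scaleE a u) => x ->.
by apply: filterS (ae_addE (a *: u : L0) v) => x ->; exact: ler_normD.
Qed.

HB.instance Definition _ :=
  GRing.isSubmodClosed.Build _ _ (Lspace_loc_pred q1) Lspace_loc_submod_closed.
HB.instance Definition _ := [SubChoice_isSubLmodule of Lspace_loc by <:].

Lemma Lspace_loc_sup_closed u v : u \in Lspace_loc_pred q1 ->
  v \in Lspace_loc_pred q1 -> (u `|` v)%VL \in Lspace_loc_pred q1.
Proof.
move=> lu lv; apply: (bound lu lv); apply: filterS (ae_supE u v) => x ->.
by case: (leP (u x : R) (v x : R)) => _; [rewrite lerDr|rewrite lerDl].
Qed.

Lemma Lspace_loc_inf_closed u v : u \in Lspace_loc_pred q1 ->
  v \in Lspace_loc_pred q1 -> (u `&` v)%VL \in Lspace_loc_pred q1.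
Proof.
move=> lu lv; apply: (bound lu lv); apply: filterS (ae_infE u v) => x ->.
by case: (leP (u x : R) (v x : R)) => _; [rewrite lerDl|rewrite lerDr].
Qed.

HB.instance Definition _ : Lmodule_isVectorLattice R Lspace_loc :=
  sub_vector_lattice Lspace_loc Lspace_loc_sup_closed Lspace_loc_inf_closed.

Lemma restriction_subproof n (u : Lspace_loc) :
  (ae_class (measurable_L0 u) : {mfun_ piece n, T >-> measurableTypeR R})
    \in Lspace_pred (piece n) q.
Proof.
by rewrite inE; apply: finite_norm_ae_class => //; have /Lspace_locP := valP u.
Qed.

Definition restriction n (u : Lspace_loc) : LspaceType (piece n) q1 :=
  Lspace_Sub q1 (restriction_subproof n u).

Lemma ae_restrictionE n (u : Lspace_loc) :
  \forall x \ae mu, Xi n x -> restriction n u x = u x :> R.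
Proof.
apply/(ae_mrestr mu (exhaustion_measurable Xi n)).
exact: (ae_classE (mu := piece n) (measurable_L0 u)).
Qed.

End Local.

Section Extension.
Context (p : \bar R) (p1 : (1 <= p)%E) (n : nat).
Implicit Types f g : LspaceType (piece n) p1.
Local Notation L0n := {mfun_ piece n, T >-> measurableTypeR R}.

Lemma measurable_extension f : measurable_fun [set: T] (f \* \1_(Xi n) : T -> R).
Proof.
apply: measurable_funM; first exact: measurable_L0.
exact/measurable_indic/exhaustion_measurable.
Qed.

Lemma extension_Lspace_subproof f :
  (ae_class (measurable_extension f) : L0) \in Lspace_pred mu p.
Proof.
rewrite inE; apply: finite_norm_ae_class => //.
apply: (finite_norm_extension (mD := exhaustion_measurable Xi n)) => //.
  exact: measurable_L0.
exact: Lspace_finite_norm.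
Qed.

Definition extension_Lspace f : LspaceType mu p1 :=
  Lspace_Sub p1 (extension_Lspace_subproof f).

Lemma extension_subproof f : extension_Lspace f \in @Lspace_c_pred p p1.
Proof.
apply/asboolP; exists n; apply: filterS (ae_classE (measurable_extension f)).
by move=> x /= -> Xx; rewrite indicE memNset// mulr0.
Qed.

Definition extension f : Lspace_c p1 := LspaceC (extension_subproof f).

Lemma ae_extensionE f :
  \forall x \ae mu, (extension f : L0) x = f x * \1_(Xi n) x :> R.
Proof. exact: ae_classE. Qed.

Let mX := exhaustion_measurable Xi n.

Lemma extension_positive : positive_operator extension.
Proof.
split=> [a f g|f f0].
  apply/val_inj/val_inj/L0P; near=> x.
  have afg : Xi n x -> ((a *: f + g : LspaceType (piece n) p1) x : R) = a * f x + g x.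
    move=> Xx.
    have := near ((ae_mrestr mu mX _).1 (ae_addE (a *: (f : L0n)) (g : L0n))) x.
    move=> /(_ _ Xx) ->//; congr (_ + _).
    by have := near ((ae_mrestr mu mX _).1 (ae_scaleE a (f : L0n))) x => /(_ _ Xx) ->.
  transitivity ((a *: f + g : LspaceType (piece n) p1) x * \1_(Xi n) x : R).
    exact: (near (ae_extensionE (a *: f + g)) x).
  transitivity (a * (extension f : L0) x + (extension g : L0) x : R); last first.
    transitivity ((a *: (extension f : L0) : L0) x + (extension g : L0) x : R).
      by rewrite (near (ae_scaleE a (extension f : L0)) x).
    apply/esym.
    exact: (near (ae_addE (a *: (extension f : L0)) (extension g : L0)) x).
  rewrite (near (ae_extensionE f) x)// (near (ae_extensionE g) x)// indicE.
  case: (boolP (x \in Xi n)); rewrite ?inE => Xx.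
    by rewrite afg// !mulr1.
  by rewrite !mulr0 addr0.
have f0' : \forall x \ae mu, Xi n x -> 0 <= f x :> R.
  apply/(ae_mrestr mu mX); apply: filterS2 f0 (ae_zeroE (mu := piece n)) => x.
  by move=> + zx; rewrite -[X in X <= _]/((0 : L0n) x : R) zx.
suff : \forall x \ae mu, (0 : L0) x <= (extension f : L0) x :> R by [].
apply: filterS3 (ae_zeroE (mu := mu)) (ae_extensionE f) f0' => x -> -> f0x.
rewrite indicE; case: (boolP (x \in Xi n)); rewrite ?inE => Xx.
  by rewrite mulr1 f0x.
by rewrite mulr0.
Unshelve. all: by end_near. Qed.
End Extension.

Section Duality.
Context (p q : \bar R) (p1 : (1 <= p)%E) (q1 : (1 <= q)%E).
Hypothesis pq : (p^-1 + q^-1 = 1)%E.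
Variable n : nat.

Let mX := exhaustion_measurable Xi n.
Local Notation L0n := {mfun_ piece n, T >-> measurableTypeR R}.

Lemma duality_integrable (u : LspaceType (piece n) q1)
    (v : LspaceType (piece n) p1) :
  mu.-integrable (Xi n) (EFin \o ((u : T -> R) \* (v : T -> R))).
Proof.
apply: (integrable_mrestr (mD := mX)).
apply: (conjugate_integrable q1 p1 _ (measurable_L0 u) (measurable_L0 v)).
- by rewrite addeC.
- exact: Lspace_finite_norm.
- exact: Lspace_finite_norm.
Qed.

Lemma duality_subproof (u : LspaceType (piece n) q1) :
  (fun v : LspaceType (piece n) p1 => \int[mu]_(x in Xi n) (u x * v x))
    \in order_dual_pred (LspaceType (piece n) p1).
Proof.
apply/order_dualP; split=> [a v w|v w].
  have uv := duality_integrable u v; have uw := duality_integrable u w.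
  have auv : mu.-integrable (Xi n) (EFin \o (fun x => a * ((u x : R) * v x))).
    exact: (integrableZl mX a uv).
  rewrite -[RHS]/(a * _ + _) -RintegralZl// -RintegralD//.
  congr fine; apply: ae_eq_integral => //.
  - exact: (measurable_int mu (duality_integrable u (a *: v + w))).
  - exact: (measurable_int mu (integrableD mX auv uw)).
  have := (ae_mrestr mu mX _).1 (ae_scaleE a (v : L0n)).
  have := (ae_mrestr mu mX _).1 (ae_addE (a *: (v : L0n)) (w : L0n)).
  apply: filterS2 => x avw av Xx; congr EFin.
  transitivity (u x * ((a *: (v : L0n) : L0n) x + w x) : R).
    by congr (_ * _); exact: avw.
  by rewrite av// mulrDr mulrCA.
have uv := integrable_norm (duality_integrable u v).
have uw := integrable_norm (duality_integrable u w).
exists (\int[mu]_(x in Xi n) (`|(u x : R) * v x| + `|(u x : R) * w x|)) => z [vz zw].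
have uz := duality_integrable u z.
apply: le_trans (le_normr_Rintegral mX uz) _.
apply: fine_le; [| |].
- exact: (integrable_fin_num mX (integrable_norm uz)).
- exact: (integrable_fin_num mX (integrableD mX uv uw)).
apply: ae_ge0_le_integral => //.
- exact: (measurable_int mu (integrable_norm uz)).
- exact: (measurable_int mu (integrableD mX uv uw)).
have := (ae_mrestr mu mX _).1 zw; have := (ae_mrestr mu mX _).1 vz.
apply: filterS2 => x vzx zwx Xx; rewrite lee_fin !normrM -mulrDr ler_wpM2l//.
have {}vzx : v x <= z x :> R by exact: vzx.
have {}zwx : z x <= w x :> R by exact: zwx.
rewrite ler_norml; apply/andP; split.
  by have := ler_norm (- v x : R); have := normr_ge0 (w x : R); rewrite normrN; lra.
by have := ler_norm (w x : R); have := normr_ge0 (v x : R); lra.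
Qed.

Definition duality (u : LspaceType (piece n) q1) :
  order_dual (LspaceType (piece n) p1) := OrderDual (duality_subproof u).

Lemma dualityE (u : LspaceType (piece n) q1) (v : LspaceType (piece n) p1) :
  duality u v = \int[mu]_(x in Xi n) (u x * v x).
Proof. by []. Qed.

End Duality.
End Spaces.
Arguments restriction {d T R mu} Xi {q} q1 n u.
Arguments extension {d T R mu} Xi {p} p1 n f.
Arguments extension_positive {d T R mu} Xi {p} p1 n.
Arguments duality {d T R mu} Xi {p q} p1 q1 pq n u.

(* Main.v *)
(* The isomorphism is the pairing u |-> (v |-> int u v). Testing against the
   indicators of {u < 0}, cut down to sets of finite measure inside the X_n,
   shows that it is an order embedding, and its values are determined by the
   condition on the e_n because every element of L^p_c is some e_n f. So the
   content is surjectivity, and by the decomposition phi = phi^+ - phi^- only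
   for positive phi. A positive phi is norm bounded on each L^p(X_n), by a
   gliding hump argument; hence A |-> phi(1_A) is countably additive on sets of
   finite measure inside X_n, and Radon-Nikodym gives a density u >= 0, first on
   each piece of a countable partition of X. Monotone convergence extends
   phi(v) = int u v from indicators to all v >= 0, and testing this against
   powers of truncations of u (or indicators of {u > K} if p = 1) shows, with
   the norm bound, that u is locally in L^q. *)

From HB Require Import structures.
Require Import Defs.
From mathcomp Require Import all_boot all_order all_algebra finmap.
From mathcomp Require Import all_classical all_reals all_analysis.
From mathcomp Require Import measurable_realfun lra.

Set Implicit Arguments.
Unset Strict Implicit.
Unset Printing Implicit Defensive.

Import Order.TTheory GRing.Theory Num.Theory.
Import numFieldNormedType.Exports.

Local Open Scope classical_set_scope.
Local Open Scope ring_scope.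

(** * Positive functionals on compactly supported L^p functions *)

Section PowerIntegral.
Context d (T : measurableType d) (R : realType) (mu : {measure set T -> \bar R}).
Context (r : R) (r1 : 1 <= r).
Implicit Types f g : T -> R.

Let r0 : 0 < r. Proof. exact: lt_le_trans r1. Qed.

(** The [r]-th power of the L^r norm. Without the root it is a plain integral, so monotone and
    dominated convergence apply to it directly. *)
Definition power_integral f : \bar R := (\int[mu]_x (`|f x| `^ r)%:E)%E.

Lemma finite_normE f :
  finite_norm mu r%:E f <-> (power_integral f < +oo)%E.
Proof.
have E : power_integral f = (\int[mu]_x (`|(EFin \o f) x| `^ r))%E by [].
rewrite E -poweR_Lnorm ?gt_eqF//; split; first exact: poweR_lty.
rewrite /finite_norm !ltey; apply: contraNN => /eqP ->.
by rewrite poweRyr ?eqxx ?gt_eqF.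
Qed.

Lemma measurable_power f : measurable_fun [set: T] f ->
  measurable_fun [set: T] (fun x => (`|f x| `^ r)%:E).
Proof.
move=> mf; apply/measurable_EFinP.
by apply: (measurableT_comp (measurable_powR r)); exact: measurableT_comp.
Qed.

Lemma power_integral_ge0 f : (0 <= power_integral f)%E.
Proof. by apply: integral_ge0 => x _; rewrite lee_fin powR_ge0. Qed.

Lemma power_integralZ c f : measurable_fun [set: T] f ->
  power_integral (fun x => c * f x) = ((`|c| `^ r)%:E * power_integral f)%E.
Proof.
move=> mf; rewrite /power_integral -ge0_integralZl_EFin ?powR_ge0//.
- by apply: eq_integral => x _; rewrite normrM powRM// EFinM.
- exact: measurable_power.
Qed.

Lemma le_power_integral f g : measurable_fun [set: T] f ->
  measurable_fun [set: T] g -> {ae mu, forall x, `|f x| <= `|g x|} ->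
  (power_integral f <= power_integral g)%E.
Proof.
move=> mf mg fg; apply: ae_ge0_le_integral => //.
- exact: measurable_power.
- exact: measurable_power.
by apply: filterS fg => x fgx _; rewrite lee_fin ge0_ler_powR ?nnegrE// ltW.
Qed.

Lemma power_integral_indic A : measurable A -> power_integral \1_A = mu A.
Proof.
move=> mA; rewrite -[A in RHS]setIT -integral_indic//; apply: eq_integral => x _.
rewrite indicE; case: (x \in A); first by rewrite normr1 powR1.
by rewrite normr0 powR0 ?gt_eqF.
Qed.

End PowerIntegral.

(** * Positive functionals and their norm bound *)

Section PositiveFunctional.
Context d (T : measurableType d) (R : realType) (mu : {measure set T -> \bar R}).
Context (r : R) (r1 : 1 <= r).
Context (X : nat -> set T) (mX : forall n, measurable (X n)).
Implicit Types f g : T -> R.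
Local Notation PI := (power_integral mu r).

Let r0 : 0 < r. Proof. exact: lt_le_trans r1. Qed.

(** Actual functions rather than classes, so that indicators, truncations and sequences can be
    handled pointwise. The index [n] is fixed so that the class is closed under sums. *)
Definition supported_class n f : Prop :=
  [/\ measurable_fun [set: T] f, (PI f < +oo)%E &
      {ae mu, forall x, ~ X n x -> f x = 0}].
Local Notation C := supported_class.

(** Monotonicity is required almost everywhere, which makes [Phi] constant on functions that agree
    almost everywhere: it is a functional on classes, written on representatives. *)
Definition positive_functional (Phi : (T -> R) -> R) : Prop :=
  [/\ forall n f g, C n f -> C n g -> Phi (f \+ g) = Phi f + Phi g,
      forall n a f, C n f -> Phi (fun x => a * f x) = a * Phi f &
      forall n f g, C n f -> C n g -> {ae mu, forall x, f x <= g x} ->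
        Phi f <= Phi g].

Lemma supported_classD n f g : C n f -> C n g -> C n (f \+ g).
Proof.
move=> [mf /(finite_normE _ r1) If f0] [mg /(finite_normE _ r1) Ig g0]; split.
- exact: measurable_funD.
- by apply/finite_normE/finite_norm_add; rewrite ?lee_fin.
- by apply: filterS2 f0 g0 => x f0 g0 Xx /=; rewrite f0// g0// addr0.
Qed.

Lemma supported_classZ n a f : C n f -> C n (fun x => a * f x).
Proof.
move=> [mf If f0]; split.
- exact: measurable_funM.
- rewrite power_integralZ//.
  by apply: lte_mul_pinfty => //; rewrite lee_fin powR_ge0.
- by apply: filterS f0 => x f0 Xx; rewrite f0// mulr0.
Qed.

Lemma supported_class_le n f g : measurable_fun [set: T] f -> C n g ->
  {ae mu, forall x, `|f x| <= `|g x|} -> C n f.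
Proof.
move=> mf [mg Ig g0] fg; split => //.
  exact: le_lt_trans (le_power_integral r1 mf mg fg) Ig.
apply: filterS2 g0 fg => x + + Xx => /(_ Xx) ->.
by rewrite normr0 normr_le0 => /eqP.
Qed.

Lemma supported_class_indic n A : measurable A -> A `<=` X n ->
  (mu A < +oo)%E -> C n \1_A.
Proof.
move=> mA AX Aoo; split; first exact: measurable_indic.
  by rewrite power_integral_indic.
by apply: aeW => x Xx; rewrite indicE memNset// => /AX.
Qed.

Context (Phi : (T -> R) -> R) (Phi_pos : positive_functional Phi).

Lemma positive_functional_ae_eq n f g : C n f -> C n g ->
  {ae mu, forall x, f x = g x} -> Phi f = Phi g.
Proof.
have [_ _ le] := Phi_pos => Cf Cg fg; apply/eqP; rewrite eq_le.
by rewrite !(le n)//; apply: filterS fg => x ->.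
Qed.

(* Gliding hump: otherwise there are v_j >= 0 with the integral of v_j^r at most
   2^-(j+1) and Phi v_j > j, and all of them lie below the function
   (sum_j v_j^r)^(1/r), which belongs to the class. *)
Lemma positive_functional_bounded n : exists2 K : R, 0 < K &
  forall f, C n f -> (forall x, 0 <= f x) -> (PI f <= 1)%E -> Phi f <= K.
Proof.
have [_ PhiZ Phi_le] := Phi_pos.
apply: contrapT => /forall2NP noK.
(* The factor [2 ^+ j.+1] in the threshold is cancelled by the scaling in [v] below, which leaves
   [Phi (v j) > j.+1]. *)
have hump (j : nat) : exists f, [/\ C n f, (forall x, 0 <= f x), (PI f <= 1)%E &
    j.+1%:R * 2 ^+ j.+1 < Phi f].
  have [|] := noK (j.+1%:R * 2 ^+ j.+1); first by rewrite mulr_gt0.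
  by move=> /existsNP[f /not_implyP[Cf /not_implyP[f0 /not_implyP[If /negP]]]];
    rewrite -ltNge => Pf; exists f.
move: hump => /choice[f /all_and4[Cf f0 If Pf]].
pose v j x := 2 ^- j.+1 * f j x.
have c0 j : 0 < 2 ^- j.+1 :> R by rewrite invr_gt0 exprn_gt0.
have v0 j x : 0 <= v j x by rewrite mulr_ge0// ltW.
have Cv j : C n (v j) by exact: supported_classZ.
have mv j : measurable_fun [set: T] (v j) by have [] := Cv j.
have mvr j := measurable_power r (mv j).
have Iv j : (PI (v j) <= (2 ^- j.+1)%:E)%E.
  rewrite power_integralZ//; last by have [] := Cf j.
  rewrite -[leRHS]mule1; apply: lee_pmul => //.
  - exact: power_integral_ge0.
  (* For [0 < c <= 1] and [r >= 1], [c ^ r <= c]. *)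
  - rewrite lee_fin gtr0_norm// ge1r_powR// c0/= invf_le1 ?exprn_gt0//.
    by rewrite exprn_ege1// ler1n.
pose h x := (\sum_(j <oo) (`|v j x| `^ r)%:E)%E.
have h0 x : (0 <= h x)%E by apply: nneseries_ge0 => j _ _; rewrite lee_fin powR_ge0.
have mh : measurable_fun [set: T] h.
  by apply: ge0_emeasurable_sum => // j x _ _; rewrite lee_fin powR_ge0.
have Ih : (\int[mu]_x h x <= 1)%E.
  rewrite integral_nneseries//.
  apply: (@le_trans _ _ (\sum_(0 <= j <oo) (1 / (2 ^ j.+1)%:R)%:E)%E);
    last exact: (epsilon_trick0 xpredT ler01).
  apply: lee_nneseries => [j _ _|j _]; first exact: power_integral_ge0.
  by rewrite (le_trans (Iv j))// lee_fin div1r natrX.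
have hoo : {ae mu, forall x, h x \is a fin_num}.
  have /integrable_ae : mu.-integrable [set: T] h.
    apply/integrableP; split => //; under eq_integral do rewrite gee0_abs//.
    exact: le_lt_trans Ih (ltry _).
  by move=> /(_ measurableT); apply: filterS => x; exact.
(* [fine] replaces infinite values of [h] by 0, which by [hoo] happens only on a null set; the
   indicator puts [w] in the class of index [n]. *)
pose w x := (fine (h x) `^ r^-1) * \1_(X n) x.
have w0 x : 0 <= w x by rewrite mulr_ge0// powR_ge0.
have mw : measurable_fun [set: T] w.
  apply: measurable_funM; last exact: measurable_indic.
  by apply: (measurableT_comp (measurable_powR _)); exact: measurableT_comp.
have Cw : C n w.
  split => //.
  - apply: le_lt_trans (ltry 1); apply: le_trans Ih.
    apply: ge0_le_integral => //.
    + exact: measurable_power.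
    + move=> x _; rewrite ger0_norm// /w powRM ?powR_ge0// -powRrM mulVf ?gt_eqF//.
      rewrite powRr1 ?fine_ge0//.
      apply: (@le_trans _ _ (fine (h x))%:E).
        rewrite lee_fin -[leRHS]mulr1 ler_wpM2l ?fine_ge0// indicE.
        by case: (x \in X n); rewrite ?powR1// powR0// gt_eqF.
      by case: (h x) (h0 x) => //= _; rewrite leey.
  - by apply: aeW => x Xx; rewrite /w indicE memNset// mulr0.
have vw j : {ae mu, forall x, v j x <= w x}.
  have [_ _ vX] := Cv j; apply: filterS2 hoo vX => x hx vX.
  have [Xx|Xx] := pselect (X n x); last by rewrite vX.
  rewrite /w indicE mem_set// mulr1.
  have -> : v j x = (v j x `^ r) `^ r^-1.
    by rewrite -powRrM mulfV ?gt_eqF// powRr1.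
  apply: ge0_ler_powR; rewrite ?nnegrE ?invr_ge0 ?powR_ge0 ?fine_ge0//.
    exact: ltW.
  rewrite -lee_fin fineK//.
  apply: le_trans (nneseries_lim_ge j.+1 _); last first.
    by move=> *; rewrite lee_fin powR_ge0.
  rewrite big_nat_recr//= (ger0_norm (v0 j x)) leeDr//.
  by apply: sume_ge0 => k _; rewrite lee_fin powR_ge0.
(* With [j] the truncation of [Phi w], the chain [j + 1 <= Phi (v j) <= Phi w < j + 1] is
   contradictory. *)
have := truncnS_gt (Phi w); rewrite ltNge => /negP; apply.
set j := Num.truncn _; apply: le_trans (Phi_le _ _ _ (Cv j) Cw (vw j)).
by rewrite (PhiZ n)// mulrC ler_pdivlMr ?exprn_gt0// ltW.
Qed.

End PositiveFunctional.

(** * The measure [A |-> Phi 1_A] and its density on a set of finite measure *)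

Section SetFunction.
Context d (T : measurableType d) (R : realType)
  (mu : {sigma_finite_measure set T -> \bar R}).
Context (r : R) (r1 : 1 <= r).
Context (X : nat -> set T) (mX : forall n, measurable (X n)).
Implicit Types f g : T -> R.
Local Notation PI := (power_integral mu r).
Local Notation C := (supported_class mu r X).
Context (Phi : (T -> R) -> R) (Phi_pos : positive_functional mu r X Phi).

Let r0 : 0 < r. Proof. exact: lt_le_trans r1. Qed.

Lemma supported_class0 n : C n (cst 0).
Proof.
split; [exact: measurable_cst| |exact: aeW].
rewrite /power_integral integral0_eq// => x _.
by rewrite /= normr0 powR0// gt_eqF.
Qed.

Lemma positive_functional0 : Phi (cst 0) = 0.
Proof.
have [_ PhiZ _] := Phi_pos.
rewrite -[RHS](mul0r (Phi (cst 0))) -(PhiZ 0%N); last exact: supported_class0.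
by congr Phi; apply/funext => x; rewrite mul0r.
Qed.

Lemma positive_functional_ge0 n f : C n f -> {ae mu, forall x, 0 <= f x} ->
  0 <= Phi f.
Proof.
have [_ _ le] := Phi_pos => Cf f0; rewrite -positive_functional0.
by apply: (le n) => //; exact: supported_class0.
Qed.

(** The bound on the unit ball applied to [f / c]. A positive upper bound [c] of the norm, instead
    of the norm itself, keeps the division valid when the norm is 0. *)
Lemma positive_functional_le_norm n : exists2 K : R, 0 < K &
  forall f (c : R), C n f -> (forall x, 0 <= f x) -> 0 < c -> (PI f <= (c `^ r)%:E)%E ->
    Phi f <= K * c.
Proof.
have [_ PhiZ _] := Phi_pos.
have [K K0 PK] := positive_functional_bounded r1 mX Phi_pos n.
exists K => // f c Cf f0 c0 Ifc.
have := PK (fun x => c^-1 * f x) (supported_classZ _ Cf).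
rewrite (PhiZ n)// ler_pdivrMl// mulrC; apply.
  by move=> x; rewrite mulr_ge0// invr_ge0 ltW.
rewrite power_integralZ//; last by case: Cf.
have cr0 : (0 <= (`|c^-1| `^ r)%:E)%E by rewrite lee_fin powR_ge0.
apply: le_trans (lee_wpmul2l cr0 Ifc) _.
rewrite -EFinM lee_fin gtr0_norm ?invr_gt0// -powRM ?invr_ge0 ?(ltW c0)//.
by rewrite mulVf ?powR1// gt_eqF.
Qed.

(** Continuity at 0, from the norm bound. It serves twice: for countable additivity on sets, and for
    the passage from simple functions to their limits. *)
Lemma positive_functional_cvg0 n (f : nat -> T -> R) :
  (forall j, C n (f j)) -> (forall j x, 0 <= f j x) ->
  PI (f j) @[j --> \oo] --> 0%E -> Phi (f j) @[j --> \oo] --> (0 : R).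
Proof.
move=> Cf f0 If.
have [K K0 PK] := positive_functional_le_norm n.
apply/cvgrPdist_le => /= e e0.
(* Once the power integral is below this level, the norm bound gives
   [Phi (f j) <= K * (e / K) = e]. *)
have Ke0 : 0 < (e / K) `^ r by rewrite powR_gt0// divr_gt0.
have : \forall j \near \oo, (PI (f j) < ((e / K) `^ r)%:E)%E.
  by apply: (If [set y | (y < _)%E]); apply: open_ereal_lt'; rewrite lte_fin.
apply: filterS => j Ij; rewrite sub0r normrN ger0_norm.
  have := PK (f j) (e / K) (Cf j) (f0 j); rewrite [K * _]mulrC divfK ?gt_eqF//.
  by apply; [rewrite divr_gt0|exact: ltW].
by apply: (positive_functional_ge0 (Cf j)); exact: aeW.
Qed.

Context (n : nat) (D : set T) (mD : measurable D) (DX : D `<=` X n)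
  (Doo : (mu D < +oo)%E).

Let subD A : measurable A -> A `<=` D -> C n \1_A.
Proof.
move=> mA AD; apply: supported_class_indic => //; first exact: subset_trans AD _.
by apply: le_lt_trans Doo; apply: le_measure; rewrite ?inE.
Qed.

Lemma positive_functional_indicU A B : measurable A -> measurable B ->
  A `<=` D -> B `<=` D -> A `&` B = set0 -> Phi \1_(A `|` B) = Phi \1_A + Phi \1_B.
Proof.
have [PhiD _ _] := Phi_pos => mA mB AD BD AB.
rewrite -(PhiD n); [congr Phi|exact: subD..]; apply/funext => x /=; rewrite !indicE in_setU.
case: (boolP (x \in A)); rewrite ?inE => xA; last by rewrite add0r.
rewrite (memNset (A := B)) /= ?addr0// => xB.
by have : (A `&` B) x by []; rewrite AB.
Qed.

(* The absolute value only matters on sets that are not measurable. *)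
Definition indic_measure (A : set T) : \bar R := `|Phi \1_(A `&` D)|%:E.

Lemma indic_measureE A : measurable A -> indic_measure A = (Phi \1_(A `&` D))%:E.
Proof.
move=> mA; rewrite /indic_measure ger0_norm//.
apply: (@positive_functional_ge0 n); last by apply: aeW => x; rewrite indicE.
by apply: subD; [exact: measurableI|exact: subIsetr].
Qed.

Let indic_measure0 : indic_measure set0 = 0%E.
Proof. by rewrite indic_measureE// set0I indic0 positive_functional0. Qed.

Let indic_measure_ge0 A : (0 <= indic_measure A)%E.
Proof. by rewrite lee_fin. Qed.

(** The partial sums telescope to [Phi 1_(B 0) - Phi 1_(B k)], where [B k] is the tail union inside
    [D]. The tails decrease to the empty set and [mu D] is finite, so [mu (B k)] tends to 0; it is
    the power integral of the indicator of [B k], hence [Phi 1_(B k)] tends to 0. *)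
Let indic_measure_additive : semi_sigma_additive indic_measure.
Proof.
move=> F mF tF mU.
pose B k := (\bigcup_(i >= k) F i) `&` D.
have mB k : measurable (B k) by apply: measurableI => //; exact: bigcup_measurable.
have BD k : B k `<=` D by exact: subIsetr.
have mFD k : measurable (F k `&` D) by exact: measurableI.
have FB k : (F k `&` D) `&` B k.+1 = set0.
  apply/seteqP; split => // x [[Fx _] [[i /= ki Fi] _]].
  move/trivIsetP : tF => /(_ k i I I); rewrite neq_ltn ki => /(_ isT) FF.
  by have : (F k `&` F i) x by []; rewrite FF.
have BS k : B k = (F k `&` D) `|` B k.+1.
  apply/seteqP; split=> [x [[i /= + Fi] Dx]|x [[Fx Dx]|[[i /= ki Fi] Dx]]].
  - rewrite leq_eqVlt => /predU1P[->|ki]; first by left.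
    by right; split => //; exists i.
  - by split => //; exists k => /=.
  - by split => //; exists i => //=; exact: ltnW.
have sumB k : (\sum_(0 <= i < k) indic_measure (F i) =
    (Phi \1_(B 0%N) - Phi \1_(B k))%:E)%E.
  elim: k => [|k IH]; first by rewrite big_nil subrr.
  rewrite big_nat_recr//= IH indic_measureE// -EFinD; congr EFin.
  rewrite (BS k) positive_functional_indicU//.
  by lra.
rewrite indic_measureE//.
rewrite (_ : (fun k => _) = (fun k => (Phi \1_(B 0%N) - Phi \1_(B k))%:E)); last first.
  exact/funext/sumB.
have -> : (\bigcup_k F k) `&` D = B 0%N.
  by congr (_ `&` _); apply/seteqP; split => x [i _ Fi]; exists i.
apply: cvg_EFin; first exact: nearW.
rewrite -[X in _ --> X]subr0; apply: cvgB; first exact: cvg_cst.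
apply: (@positive_functional_cvg0 n) => [k|k x|]; [exact: subD|by rewrite indicE|].
have capB : \bigcap_k B k = set0.
  apply/seteqP; split => // x Bx.
  have [[i _ Fi] Dx] := Bx 0%N I; have Bi := Bx i.+1 I.
  by have : ((F i `&` D) `&` B i.+1) x by []; rewrite FB.
rewrite -(measure0 mu) -capB.
under eq_fun do rewrite power_integral_indic//.
apply: nonincreasing_cvg_mu => //.
- by apply: le_lt_trans Doo; apply: le_measure; rewrite ?inE.
- by rewrite capB.
- move=> k l kl; apply/subsetPset => x [[i /= li Fi] Dx].
  by split => //; exists i => //=; exact: leq_trans li.
Qed.

HB.instance Definition _ := isMeasure.Build _ _ _ indic_measure
  indic_measure0 indic_measure_ge0 indic_measure_additive.

Let indic_measure_fin : fin_num_fun indic_measure.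
Proof. by move=> A mA; rewrite /indic_measure. Qed.

HB.instance Definition _ := Measure_isFinite.Build _ _ _ indic_measure
  indic_measure_fin.

Lemma indic_measure_dominated : indic_measure `<< mu.
Proof.
apply/null_content_dominatesP => A mA A0; rewrite indic_measureE//; congr EFin.
rewrite -positive_functional0; apply: (positive_functional_ae_eq Phi_pos (n := n)).
- by apply: subD; [exact: measurableI|exact: subIsetr].
- exact: supported_class0.
exists A; split => // x /=; apply: contra_notP => Ax.
by rewrite indicE memNset// => -[].
Qed.

(** Radon-Nikodym. The set [A] need not lie in [D]: the identity also says that [f] has integral 0
    off [D], which allows the densities of disjoint pieces to be summed. *)
Lemma positive_functional_density : exists f : T -> \bar R,
  [/\ forall x, (0 <= f x)%E, measurable_fun [set: T] f &
      forall A, measurable A -> (Phi \1_(A `&` D))%:E = (\int[mu]_(x in A) f x)%E].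
Proof.
have [f [f0 _ If fE]] := radon_nikodym_sigma_finite indic_measure_dominated.
exists f; split => // [|A mA]; first exact: measurable_int If.
by rewrite -fE//; exact/esym/indic_measureE.
Qed.

End SetFunction.

(** * Representation by a density *)

Section Representation.
Context d (T : measurableType d) (R : realType)
  (mu : {sigma_finite_measure set T -> \bar R}).
Context (r : R) (r1 : 1 <= r).
Context (X : nat -> set T) (mX : forall n, measurable (X n))
  (ndX : forall m n, (m <= n)%N -> X m `<=` X n)
  (cX : \bigcup_n X n = [set: T]).
Implicit Types f g v : T -> R.
Local Notation PI := (power_integral mu r).
Local Notation C := (supported_class mu r X).

Let r0 : 0 < r. Proof. exact: lt_le_trans r1. Qed.

(** The sets [X n] may have infinite measure, and then their indicators are not in L^r. Intersecting
    them with an exhaustion by sets of finite measure repairs this. *)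
Lemma finite_measure_exhaustion : exists Y : nat -> set T,
  [/\ forall n, measurable (Y n), forall m n, (m <= n)%N -> Y m `<=` Y n,
      forall n, Y n `<=` X n, forall n, (mu (Y n) < +oo)%E &
      \bigcup_n Y n = [set: T]].
Proof.
have [F [cF ndF /all_and2[mF Foo]]] := (sigma_finiteP _ _).1 (sigma_finiteT mu).
have {}ndF m n : (m <= n)%N -> F m `<=` F n by move=> /ndF/subsetPset.
exists (fun n => X n `&` F n); split => [n|m n mn|n|n|].
- exact: measurableI.
- by apply: setISS; [exact: ndX|exact: ndF].
- exact: subIsetl.
- apply: le_lt_trans (Foo n); apply: le_measure; rewrite ?inE//.
  exact: measurableI.
- apply/seteqP; split => // x _.
  have [m _ Xm] : (\bigcup_n X n) x by rewrite cX.
  have [n _ Fn] : (\bigcup_n F n) x by rewrite -cF.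
  exists (maxn m n) => //; split; first exact: ndX (leq_maxl _ _) _ Xm.
  exact: ndF (leq_maxr _ _) _ Fn.
Qed.

Context (Phi : (T -> R) -> R) (Phi_pos : positive_functional mu r X Phi).
Context (Y : nat -> set T) (mY : forall n, measurable (Y n))
  (ndY : forall m n, (m <= n)%N -> Y m `<=` Y n)
  (YX : forall n, Y n `<=` X n) (Yoo : forall n, (mu (Y n) < +oo)%E)
  (cY : \bigcup_n Y n = [set: T]).

(** The sets [Y k] are made disjoint and the densities on the pieces are summed. A subset of [Y m]
    meets only the first [m.+1] pieces, so finite additivity of [Phi] is enough to glue. *)
Lemma exhaustion_indic_density : exists g : T -> \bar R,
  [/\ forall x, (0 <= g x)%E, measurable_fun [set: T] g &
      forall m A, measurable A -> A `<=` Y m ->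
        (Phi \1_A)%:E = (\int[mu]_(x in A) g x)%E].
Proof.
pose D := seqDU Y.
have mD k : measurable (D k).
  by apply: measurableD => //; exact: bigsetU_measurable.
have DY k : D k `<=` Y k by exact: subDsetl.
have DX k : D k `<=` X k by exact: subset_trans (DY k) (YX (n := k)).
have Doo k : (mu (D k) < +oo)%E.
  by apply: le_lt_trans (Yoo k); apply: le_measure; rewrite ?inE.
have /choice[f /all_and3[f0 mf fE]] k :=
  positive_functional_density r1 mX Phi_pos (mD k) (DX k) (Doo k).
exists (fun x => \sum_(k <oo) f k x)%E; split => [x|| m A mA AY].
- by apply: nneseries_ge0 => k _ _.
- by apply: ge0_emeasurable_sum => // k x _ _.
rewrite integral_nneseries//; last first.
  by move=> k; exact: measurable_funTS.
under eq_eseriesr do rewrite -fE//.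
have sumE j : \sum_(0 <= k < j) Phi \1_(A `&` D k) =
    Phi \1_(A `&` \big[setU/set0]_(k < j) Y k).
  rewrite bigsetU_seqDU; elim: j => [|j IH].
    by rewrite big_nil big_ord0 setI0 indic0 (positive_functional0 r1 Phi_pos).
  rewrite big_nat_recr//= IH big_ord_recr/= setIUr.
  rewrite (positive_functional_indicU r1 Phi_pos (mY m) (YX (n := m)) (Yoo m))//.
  - by apply: measurableI => //; apply: bigsetU_measurable => k _; exact: mD.
  - exact: measurableI.
  - by move=> x [/AY].
  - by move=> x [/AY].
  - rewrite setIACA setIid /D -bigsetU_seqDU; apply/seteqP; split => // x [_].
    by rewrite /seqDU => -[? []].
have AD0 k : 0 <= Phi \1_(A `&` D k).
  apply: (positive_functional_ge0 r1 Phi_pos (n := k)); last first.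
    by apply: aeW => x; rewrite indicE.
  apply: supported_class_indic => //; first exact: measurableI.
    by move=> x [_ /DX].
  apply: le_lt_trans (Doo k); apply: le_measure; rewrite ?inE//.
  exact: measurableI.
rewrite (nneseries_split 0 m.+1)//; last by move=> k _; rewrite lee_fin.
rewrite eseries0 ?adde0; last first.
  move=> k mk _; rewrite (_ : A `&` D k = set0).
    by rewrite indic0 (positive_functional0 r1 Phi_pos).
  apply/seteqP; split => // x [/AY Yx [_]]; apply.
  by rewrite -bigcup_mkord; exists m.
rewrite sumEFin sumE; congr (Phi \1_ _)%:E.
apply/esym/setIidPl; apply: subset_trans AY _ => x Yx.
by rewrite -bigcup_mkord; exists m => /=.
Qed.

Import HBNNSimple.

(** Linearity extends the identity from indicators to simple functions; the cut by [Y m] makes every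
    level set one of finite measure inside [X m]. *)
Lemma simple_representation (g : T -> \bar R) m :
  (forall x, (0 <= g x)%E) -> measurable_fun [set: T] g ->
  (forall A, measurable A -> A `<=` Y m -> (Phi \1_A)%:E = (\int[mu]_(x in A) g x)%E) ->
  forall s : {nnsfun T >-> R},
    C m (fun x => s x * \1_(Y m) x) /\
    (Phi (fun x => s x * \1_(Y m) x))%:E =
      (\int[mu]_x ((s x * \1_(Y m) x)%:E * g x))%E.
Proof.
have [PhiD PhiZ _] := Phi_pos => g0 mg gE s.
(* Arbitrary nonnegative coefficients and measurable sets, so that the induction on the number of
   terms need not preserve the canonical form of a simple function. *)
have step (N : nat) (c : nat -> R) (A : nat -> set T) :
    (forall i, (i < N)%N -> 0 <= c i) -> (forall i, measurable (A i)) ->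
    let f x := \sum_(i < N) c i * \1_(A i `&` Y m) x in
    C m f /\ (Phi f)%:E = (\int[mu]_x ((f x)%:E * g x))%E.
  move=> c0 mA; elim: N c0 => [|N IH] c0 f.
    have -> : f = cst 0 by apply/funext => x; rewrite /f big_ord0.
    split; first exact: supported_class0.
    rewrite (positive_functional0 r1 Phi_pos) integral0_eq// => x _.
    by rewrite mul0e.
  have [|Cf' PE'] := IH; first by move=> i iN; apply: c0; exact: ltnW.
  set f' := (fun x => _) in Cf' PE'.
  have fE : f = f' \+ (fun x => c N * \1_(A N `&` Y m) x).
    by apply/funext => x; rewrite /f big_ord_recr.
  have mAY : measurable (A N `&` Y m) by exact: measurableI.
  have CA : C m \1_(A N `&` Y m).
    apply: supported_class_indic => //; first by move=> x [_ /YX].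
    by apply: le_lt_trans (Yoo m); apply: le_measure; rewrite ?inE.
  have cN : 0 <= c N by exact: c0.
  have Cc := supported_classZ (c N) CA.
  rewrite fE; split; first exact: supported_classD.
  rewrite (PhiD m)// (PhiZ m)// EFinD PE' EFinM gE//.
  have f'0 x : 0 <= f' x.
    apply: sumr_ge0 => i _; apply: mulr_ge0; last by rewrite indicE.
    by apply: c0; rewrite ltnS ltnW.
  have mf' : measurable_fun [set: T] f' by case: Cf'.
  under [RHS]eq_integral => x _.
    rewrite EFinD ge0_muleDl ?lee_fin//; last by rewrite mulr_ge0// indicE.
    over.
  rewrite ge0_integralD//; last 4 first.
  - by move=> x _; rewrite mule_ge0// lee_fin.
  - by apply: emeasurable_funM => //; exact/measurable_EFinP.
  - by move=> x _; rewrite mule_ge0// lee_fin mulr_ge0// indicE.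
  - apply: emeasurable_funM => //; apply/measurable_EFinP.
    by apply: measurable_funM => //; exact: measurable_indic.
  congr (_ + _)%E; under eq_integral do rewrite EFinM -muleA.
  rewrite ge0_integralZl_EFin//; last 2 first.
  - by move=> x _; rewrite mule_ge0// lee_fin indicE.
  - apply: emeasurable_funM => //; apply/measurable_EFinP.
    exact: measurable_indic.
  congr (_ * _)%E; rewrite [LHS]integral_mkcond; apply: eq_integral => x _.
  rewrite /patch indicE; case: (x \in _); rewrite ?mul1e ?mul0e//.
pose S := fset_set (range s).
have [||Cf PE] := step #|`S| (nth 0 S) (fun i => s @^-1` [set S`_i]).
- move=> i iS; have : S`_i \in S by exact: mem_nth.
  by rewrite in_fset_set// inE => -[x _ <-]; exact: fun_ge0.
- by move=> i; exact: measurable_sfunP.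
have sE x : s x * \1_(Y m) x =
    \sum_(i < #|`S|) S`_i * \1_(s @^-1` [set S`_i] `&` Y m) x.
  rewrite fimfunEord mulr_suml; apply: eq_bigr => i _.
  by rewrite indicI mulrA.
rewrite (funext sE); split; first exact: Cf.
by rewrite PE; apply: eq_integral => x _; rewrite sE.
Qed.


(** Increasing simple functions cut down to [Y m] approximate [v] from below. Both sides pass to the
    limit: the integral by monotone convergence, [Phi] because dominated convergence makes the power
    integral of the difference tend to 0. *)
Lemma positive_functional_representation (g : T -> \bar R) :
  (forall x, (0 <= g x)%E) -> measurable_fun [set: T] g ->
  (forall m A, measurable A -> A `<=` Y m ->
    (Phi \1_A)%:E = (\int[mu]_(x in A) g x)%E) ->
  forall n v, C n v -> (forall x, 0 <= v x) ->
    (Phi v)%:E = (\int[mu]_x ((v x)%:E * g x))%E.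
Proof.
have [PhiD PhiZ _] := Phi_pos => g0 mg gE n v Cv v0.
have [mv Iv _] := Cv.
have mev : measurable_fun [set: T] (EFin \o v) by exact/measurable_EFinP.
pose s := nnsfun_approx measurableT mev.
have nds x : {homo s^~ x : m k / (m <= k)%N >-> m <= k}.
  by move=> m k mk; have /lefP := nd_nnsfun_approx measurableT mev mk; exact.
have cvs x : s m x @[m --> \oo] --> v x.
  have f0 y : [set: T] y -> (0 <= (EFin \o v) y)%E by rewrite lee_fin.
  by have /fine_cvgP[] := cvg_nnsfun_approx measurableT mev f0 (x := x) I.
have sv m x : s m x <= v x.
  rewrite -(cvg_lim _ (cvs x))//; apply: (nondecreasing_cvgn_le (nds x)).
  by apply/cvg_ex; exists (v x).
pose w m x := s m x * \1_(Y m) x.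
have w0 m x : 0 <= w m x by rewrite mulr_ge0// ?indicE.
have wv m x : w m x <= v x.
  rewrite /w indicE; case: (x \in _); rewrite ?mulr1// mulr0//.
have mw m : measurable_fun [set: T] (w m).
  by apply: measurable_funM => //; exact: measurable_indic.
have Cw m : C n (w m).
  apply: (supported_class_le r1 (mw m) Cv); apply: aeW => x.
  by rewrite !ger0_norm.
have cvw x : w m x @[m --> \oo] --> v x.
  have [N _ YN] : (\bigcup_n Y n) x by rewrite cY.
  apply: cvg_trans (cvs x); apply: near_eq_cvg; near=> m.
  rewrite /w indicE mem_set ?mulr1//; apply: ndY YN; near: m.
  exact: nbhs_infty_ge.
(* The difference is written as a sum with a multiple by -1, the form to which the closure
   properties and the linearity of [Phi] apply. *)
have Cvw m : C n (v \+ (fun x => - 1 * w m x)).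
  by apply: supported_classD => //; exact: supported_classZ.
have PE m : Phi (w m) = Phi v - Phi (v \+ (fun x => - 1 * w m x)).
  rewrite (PhiD n)//; last exact: supported_classZ.
  by rewrite (PhiZ n)//; lra.
have cvP : Phi (w m) @[m --> \oo] --> Phi v.
  rewrite (funext PE) -[Phi v in X in _ --> X]subr0.
  apply: cvgB; first exact: cvg_cst.
  apply: (positive_functional_cvg0 r1 mX Phi_pos (n := n)) => // [m x|].
    by rewrite /= mulN1r subr_ge0.
  have mvr := measurable_power r mv.
  have [|||||_ _] := @dominated_convergence _ _ _ mu [set: T] measurableT
    (fun m x => (`|(v \+ (fun x => - 1 * w m x)) x| `^ r)%:E) (cst 0%E)
    (fun x => (`|v x| `^ r)%:E).
  - by move=> m; apply: measurable_power; case: (Cvw m).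
  - exact: measurable_cst.
  - apply: aeW => x _; apply: cvg_EFin; first exact: nearW.
    apply/cvgrPdist_le => /= e e0.
    have er0 : 0 < e `^ r^-1 by exact: powR_gt0.
    move/cvgrPdist_le : (cvw x) => /(_ _ er0); apply: filterS => m vw.
    rewrite sub0r normrN ger0_norm ?powR_ge0// mulN1r.
    rewrite (_ : e = (e `^ r^-1) `^ r); last first.
      by rewrite -powRrM mulVf ?powRr1 ?(ltW e0)// gt_eqF.
    by apply: ge0_ler_powR; rewrite ?nnegrE ?(ltW r0)// ?powR_ge0.
  - apply/integrableP; split => //.
    by under eq_integral do rewrite gee0_abs ?lee_fin ?powR_ge0//.
  - apply: aeW => x m _; rewrite gee0_abs ?lee_fin ?powR_ge0//.
    rewrite ge0_ler_powR ?nnegrE// ?(ltW r0)//= mulN1r.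
    by rewrite !ger0_norm// ?subr_ge0// gerBl.
  by rewrite integral0.
have cvI : (\int[mu]_x ((w m x)%:E * g x))%E @[m --> \oo] -->
    (\int[mu]_x ((v x)%:E * g x))%E.
  have -> : (\int[mu]_x ((v x)%:E * g x) =
      \int[mu]_x limn (fun m => (w m x)%:E * g x))%E.
    apply: eq_integral => x _; apply/esym/cvg_lim => //.
    (* If [v x = 0] and [g x] is infinite, the product of the limits has the form 0 times infinity;
       but then every [w m x] is 0 and the products are constant. *)
    have [vx0|vx0] := eqVneq (v x) 0.
      rewrite vx0 mul0e; apply: cvg_near_cst; apply: nearW => m.
      have -> : w m x = 0 by apply/eqP; rewrite eq_le w0 andbT -vx0.
      by rewrite mul0e.
    apply: cvgeM; last exact: cvg_cst.
      have [gx|gx] := boolP (g x \is a fin_num); first exact: mule_def_fin.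
      by apply: mule_def_neq0_infty => //; rewrite eqe.
    by apply: cvg_EFin; [exact: nearW|exact: cvw].
  apply: cvg_monotone_convergence => //.
  - by move=> m; apply: emeasurable_funM => //; exact/measurable_EFinP.
  - by move=> m x _; rewrite mule_ge0// lee_fin.
  - move=> x _ m k mk; apply: lee_wpmul2r => //; rewrite lee_fin.
    apply: ler_pM => //; first exact: nds.
    rewrite !indicE ler_nat; case: (boolP (x \in Y m)) => //.
    by rewrite inE => /(ndY mk) Yx; rewrite mem_set.
have cvPE : (Phi (w m))%:E @[m --> \oo] --> (Phi v)%:E.
  by apply: cvg_EFin; [exact: nearW|exact: cvP].
apply: (cvg_unique _ cvPE); first exact: ereal_hausdorff.
apply: cvg_trans cvI; apply: near_eq_cvg; apply: nearW => m.
by have [_ ->] := simple_representation g0 mg (gE m) (s m).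
Unshelve. all: by end_near. Qed.

End Representation.

(** Cutting [f] to [D] changes it on a null set of the restricted measure only, and on subsets of
    [D] the two measures agree. *)
Lemma integral_mrestr d (T : measurableType d) (R : realType)
    (mu : {measure set T -> \bar R}) (D : set T) (mD : measurable D)
    (f : T -> \bar R) : measurable_fun [set: T] f ->
  (\int[mrestr mu mD]_x f x = \int[mu]_(x in D) f x)%E.
Proof.
move=> mf; transitivity (\int[mrestr mu mD]_x (f \_ D) x)%E.
  apply: ae_eq_integral => //.
    apply/(measurable_restrictT _ _).1 => //; exact: measurable_funTS.
  by apply/ae_mrestr/aeW => x Dx _; rewrite patchE mem_set.
rewrite -integral_mkcond; apply: eq_measure_integral => A mA AD.
by rewrite /= /mrestr setIidl.
Qed.

(** * Finiteness of the density and its membership in L^q on each piece *)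

Section Density.
Context d (T : measurableType d) (R : realType)
  (mu : {sigma_finite_measure set T -> \bar R}).
Context (r : R) (r1 : 1 <= r).
Context (X : nat -> set T) (mX : forall n, measurable (X n))
  (ndX : forall m n, (m <= n)%N -> X m `<=` X n)
  (cX : \bigcup_n X n = [set: T]).
Implicit Types f g v : T -> R.
Local Notation PI := (power_integral mu r).
Local Notation C := (supported_class mu r X).
Context (Phi : (T -> R) -> R) (Phi_pos : positive_functional mu r X Phi).

Let r0 : 0 < r. Proof. exact: lt_le_trans r1. Qed.

(** The extended density has integral [Phi 1_(Y m)], a real number, over each [Y m]; so it is finite
    almost everywhere and [fine] changes it on a null set only. *)
Lemma positive_functional_real_density : exists u : T -> R,
  [/\ measurable_fun [set: T] u, forall x, 0 <= u x &
      forall n v, C n v -> (forall x, 0 <= v x) ->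
        (Phi v)%:E = (\int[mu]_x (v x * u x)%:E)%E].
Proof.
have [Y [mY ndY YX Yoo cY]] := finite_measure_exhaustion mu mX ndX cX.
have [g [g0 mg gE]] := exhaustion_indic_density r1 mX Phi_pos mY YX Yoo.
have gfin : {ae mu, forall x, g x \is a fin_num}.
  have gY m : {ae mu, forall x, Y m x -> g x \is a fin_num}.
    apply: integrable_ae => //; apply/integrableP; split.
      exact: measurable_funTS.
    by under eq_integral do rewrite gee0_abs//; rewrite -(gE m)// ltry.
  have := ae_foralln gY; apply: filterS => x gYx.
  have [m _ Ym] : (\bigcup_n Y n) x by rewrite cY.
  exact: gYx Ym.
exists (fine \o g); split => [|x|n v Cv v0].
- exact: measurableT_comp.
- exact: fine_ge0.
rewrite (positive_functional_representation r1 mX Phi_pos mY ndY YX Yoo cY g0 mg gE Cv)//.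
have [mv _ _] := Cv.
apply: ae_eq_integral => //.
- by apply: emeasurable_funM => //; exact/measurable_EFinP.
- apply/measurable_EFinP; apply: measurable_funM => //.
  exact: measurableT_comp.
by apply: filterS gfin => x gx _; rewrite EFinM /= fineK.
Qed.

Context (u : T -> R) (mu_ : measurable_fun [set: T] u) (u0 : forall x, 0 <= u x)
  (uE : forall n v, C n v -> (forall x, 0 <= v x) ->
    (Phi v)%:E = (\int[mu]_x (v x * u x)%:E)%E).

(** The bound is the norm constant [K] itself. On the part [A] of [X n] and [Y m] where [u > K], the
    integral of [u] is [Phi 1_A <= K * mu A], which forces [mu A = 0]. *)
Lemma density_locally_bounded n : r = 1 -> exists M,
  {ae mu, forall x, X n x -> u x <= M}.
Proof.
move=> rE; have [Y [mY ndY YX Yoo cY]] := finite_measure_exhaustion mu mX ndX cX.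
have [K K0 PK] := positive_functional_le_norm r1 mX Phi_pos n.
exists K.
suff bound m : {ae mu, forall x, ~ (X n `&` Y m `&` [set x | K < u x]) x}.
  have := ae_foralln bound; apply: filterS => x boundx Xx.
  have [m _ Ym] : (\bigcup_n Y n) x by rewrite cY.
  by rewrite leNgt; apply/negP => Ku; exact: (boundx m).
set A := _ `&` [set x | _].
have mA : measurable A.
  apply: measurableI; first exact: measurableI.
  rewrite (_ : [set x | _] = [set: T] `&` u @^-1` `]K, +oo[); first exact: mu_.
  by apply/seteqP; split => x /=; rewrite in_itv/= andbT; [|case].
have Aoo : (mu A < +oo)%E.
  apply: le_lt_trans (Yoo m); apply: le_measure; rewrite ?inE//.
  by move=> x [[]].
have CA : C n \1_A by apply: supported_class_indic => // x [[]].
have A0 x : 0 <= \1_A x :> R by rewrite indicE.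
have [muA0|muA0] := eqVneq (mu A) 0.
  by exists A; split => // x /contrapT.
pose c := fine (mu A).
have c0 : 0 < c by rewrite fine_gt0// Aoo lt0e muA0 measure_ge0.
have cE : mu A = c%:E by rewrite fineK// ge0_fin_numE.
have cr : (PI \1_A <= (c `^ r)%:E)%E.
  rewrite (power_integral_indic mu r1 mA) rE powRr1 ?(ltW c0)//.
  by rewrite -cE.
have := PK _ c CA A0 c0 cr.
rewrite -lee_fin (uE CA)//.
(* The excess over [K] is nonnegative with integral at most 0, hence null almost everywhere,
   although it is positive on [A]. *)
pose h x := \1_A x * (u x - K).
have h0 x : 0 <= h x.
  rewrite /h indicE; case: (boolP (x \in A)); rewrite ?inE; last by rewrite mul0r.
  by move=> [_ /= /ltW Ku]; rewrite mul1r subr_ge0.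
have mh : measurable_fun [set: T] h.
  by apply: measurable_funM => //; exact: measurable_funB.
have m1A : measurable_fun [set: T] (EFin \o (\1_A : T -> R)).
  exact/measurable_EFinP/measurable_indic.
have -> : (\int[mu]_x (\1_A x * u x)%:E = \int[mu]_x (h x)%:E + (K * c)%:E)%E.
  rewrite EFinM -cE -[A in mu A]setIT -(integral_indic mu)//.
  rewrite -ge0_integralZl_EFin ?(ltW K0)// -ge0_integralD//.
  - by apply: eq_integral => x _; rewrite -EFinM -EFinD; congr EFin; rewrite /h; lra.
  - by move=> x _; rewrite lee_fin.
  - exact/measurable_EFinP.
  - by move=> x _; rewrite -EFinM lee_fin mulr_ge0// ltW.
  - exact: measurable_funeM.
rewrite -leeBrDr// subee// => Ih.
have Ih0 : (\int[mu]_x `|(h x)%:E| = 0)%E.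
  apply/eqP; rewrite eq_le integral_ge0 ?andbT//.
  by under eq_integral do rewrite gee0_abs ?lee_fin//.
have := (ae_eq_integral_abs mu measurableT _).1 Ih0.
move=> /(_ ((measurable_EFinP _ _).2 mh)); apply: filterS => x /(_ I)[] hx Ax.
by move: hx Ax.2; rewrite /h indicE mem_set// mul1r /= => /subr0_eq ->; rewrite ltxx.
Qed.

(** The converse of Hoelder. For a bounded truncation [a] of [u] and [v = a ^ (s - 1)], the relation
    [(s - 1) * r = s] gives, with [I] the integral of [a ^ s], [I <= Phi v <= K * I ^ (1 / r)],
    hence [I <= K ^ s]. This bound is uniform in the truncation. *)
Lemma density_locally_power_integrable n s : 1 <= s -> r^-1 + s^-1 = 1 ->
  (\int[mu]_(x in X n) (u x `^ s)%:E < +oo)%E.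
Proof.
move=> s1 rs.
have s0 : 0 < s by exact: lt_le_trans s1.
(* [s = 1] would force [1 / r = 0]. *)
have {}s1 : 1 < s.
  rewrite lt_neqAle s1 andbT; apply/eqP => sE; move: rs; rewrite -sE invr1.
  by move/(canRL (addrK _)); rewrite subrr => /eqP; rewrite invr_eq0 gt_eqF.
have rsE : (s - 1) * r = s.
  have : r * s * (r^-1 + s^-1) = r * s by rewrite rs mulr1.
  rewrite mulrDr mulrAC divff ?gt_eqF// mul1r mulfK ?gt_eqF//; lra.
have [Y [mY ndY YX Yoo cY]] := finite_measure_exhaustion mu mX ndX cX.
have [K K0 PK] := positive_functional_le_norm r1 mX Phi_pos n.
pose Z m := X n `&` Y m.
have mZ m : measurable (Z m) by exact: measurableI.
have Zoo m : (mu (Z m) < +oo)%E.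
  by apply: le_lt_trans (Yoo m); apply: le_measure; rewrite ?inE//; exact: subIsetr.
pose a m x := Num.min (u x) m%:R * \1_(Z m) x.
have a0 m x : 0 <= a m x by rewrite mulr_ge0// ?indicE// le_min u0 ler0n.
have au m x : a m x <= u x.
  by rewrite /a indicE; case: (x \in _); rewrite ?mulr1 ?mulr0// ge_min lexx.
have ma m : measurable_fun [set: T] (a m).
  apply: measurable_funM; last exact: measurable_indic.
  by apply: measurable_minr => //; exact: measurable_cst.
have mpa e m : measurable_fun [set: T] (fun x => a m x `^ e).
  by apply: (measurableT_comp (measurable_powR e)).
pose v m x := a m x `^ (s - 1).
have v0 m x : 0 <= v m x by exact: powR_ge0.
have Cv m : C n (v m).
  apply: (@supported_class_le _ _ _ _ _ r1 _ _ _
    (fun x => m%:R `^ (s - 1) * \1_(Z m) x)); first exact: mpa.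
    apply/supported_classZ/supported_class_indic => //; last exact: Zoo.
    by move=> x [].
  apply: aeW => x; rewrite !ger0_norm ?mulr_ge0 ?powR_ge0 ?indicE// /v /a indicE.
  case: (x \in Z m); last by rewrite !mulr0 powR0 ?gt_eqF// subr_gt0.
  rewrite !mulr1 ge0_ler_powR ?nnegrE ?subr_ge0 ?(ltW s1)//.
    by rewrite le_min u0 ler0n.
  by rewrite ge_min lexx orbT.
have IvE m : PI (v m) = (\int[mu]_x (a m x `^ s)%:E)%E.
  by apply: eq_integral => x _; rewrite ger0_norm// /v -powRrM rsE.
have Ivoo m : PI (v m) \is a fin_num.
  by rewrite ge0_fin_numE ?power_integral_ge0//; case: (Cv m).
have IP m : (PI (v m) <= (Phi (v m))%:E)%E.
  rewrite (uE (Cv m))// IvE; apply: ge0_le_integral => //.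
  - by move=> x _; rewrite lee_fin powR_ge0.
  - exact/measurable_EFinP/mpa.
  - by apply/measurable_EFinP/measurable_funM => //; exact: mpa.
  (* [a ^ s = a * a ^ (s - 1) <= u * a ^ (s - 1)]. *)
  - by move=> x _; rewrite lee_fin /v -mulr_powRB1// mulrC ler_wpM2l// powR_ge0.
have IK m : (PI (v m) <= (K `^ s)%:E)%E.
  have := IP m; have := Ivoo m; have := power_integral_ge0 mu r (v m).
  case E : (PI (v m)) => [j| |]//; rewrite !lee_fin le_eqVlt.
  move=> /predU1P[<- _ _|j0 _ jP]; first exact: powR_ge0.
  have jr0 : 0 < j `^ r^-1 by exact: powR_gt0.
  (* Dividing by [j ^ (1 / r)] requires the integral [j] to be finite and positive; both were
     secured above, with [j = 0] settled separately. *)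
  have : j <= K * j `^ r^-1.
    apply: le_trans jP _; apply: PK => //.
    by rewrite -powRrM mulVf ?gt_eqF// powRr1 ?(ltW j0)// E.
  rewrite -ler_pdivrMr//.
  have -> : j / j `^ r^-1 = j `^ s^-1.
    rewrite -{1}(powRr1 (ltW j0)) -powRB; last first.
      by rewrite (gt_eqF j0) implybT.
    by congr (_ `^ _); lra.
  move=> jK; have -> : j = (j `^ s^-1) `^ s.
    by rewrite -powRrM mulVf ?gt_eqF// powRr1// ltW.
  by apply: ge0_ler_powR; rewrite ?nnegrE ?powR_ge0 ?(ltW s0) ?(ltW K0).
apply: le_lt_trans (ltry (K `^ s)).
have -> : (\int[mu]_(x in X n) (u x `^ s)%:E =
    \int[mu]_x limn (fun m => (a m x `^ s)%:E))%E.
  rewrite integral_mkcond; apply: eq_integral => x _; apply/esym/cvg_lim => //.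
  have [N _ YN] : (\bigcup_n Y n) x by rewrite cY.
  (* The truncations are eventually constant at [x]: on [X n] as soon as [Y m] contains [x] and
     [m >= u x], off [X n] always 0. *)
  apply: cvg_near_cst; near=> m.
  rewrite patchE /a indicE /Z; have [Xx|Xx] := boolP (x \in X n); last first.
    rewrite memNset ?mulr0 ?powR0 ?gt_eqF// => -[].
    by move: Xx; rewrite notin_setE.
  rewrite mem_set ?mulr1; last first.
    split; first by rewrite inE in Xx.
    by apply: ndY YN; near: m; exact: nbhs_infty_ge.
  congr (_ `^ _)%:E; apply/min_idPl; near: m; exact: nbhs_infty_ger.
have nda x k m : (k <= m)%N -> ((a k x `^ s)%:E <= (a m x `^ s)%:E)%E.
  move=> km; rewrite lee_fin ge0_ler_powR ?nnegrE ?(ltW s0)//.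
  apply: ler_pM; rewrite ?le_min ?u0 ?ler0n ?indicE//.
    by rewrite !ge_min lexx/= ler_nat km orbT.
  rewrite ler_nat; case: (boolP (x \in Z k)) => //; rewrite inE => -[Xx Yx].
  by rewrite mem_set//; split => //; exact: ndY Yx.
have pa0 k x : (0 <= (a k x `^ s)%:E)%E by rewrite lee_fin powR_ge0.
rewrite monotone_convergence//.
- apply: lime_le; last by apply: nearW => m; rewrite -IvE.
  apply: ereal_nondecreasing_is_cvgn => k m km.
  by apply: ge0_le_integral => // [||x _]; [exact/measurable_EFinP/mpa..|exact: nda].
- by move=> m; exact/measurable_EFinP/mpa.
- by move=> x _ k m; exact: nda.
Unshelve. all: by end_near. Qed.

(** The two previous estimates cover the two cases: [q] finite, and [q] infinite, where conjugacy
    forces [r = 1]. *)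
Lemma density_finite_norm q n : (1 <= q)%E -> ((r%:E)^-1 + q^-1 = 1)%E ->
  finite_norm (mrestr mu (mX n)) q u.
Proof.
move=> q1 rq; case: q q1 rq => [s| |]//.
- rewrite lee_fin => s1.
  have s0 : 0 < s by exact: lt_le_trans s1.
  rewrite !inver !gt_eqF// -EFinD => -[rs].
  apply/(finite_normE _ s1); rewrite /power_integral integral_mrestr.
    by under eq_integral do rewrite ger0_norm//;
      exact: density_locally_power_integrable.
  exact: measurable_power.
- move=> _; rewrite invey adde0 => /eqP; rewrite inve_eq1 => /eqP -[rE].
  have [M uM] := density_locally_bounded n rE.
  apply/finite_norm_oo => //; exists M; apply/ae_mrestr.
  by apply: filterS uM => x uM Xx; rewrite ger0_norm// uM.
Qed.

End Density.

(** * Order duals and the pairing *)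

Section VectorLattices.
Context (R : realType) (E F : vectorLatticeType R).

(** By linearity, preserving and reflecting positivity is an order embedding. Once it is onto, each
    supremum or infimum in [F] is some [S z] and can be compared inside [E]. *)
Lemma lattice_isomorphism_of_order_embedding (S : E -> F) : linear S ->
  (forall x, (0 <= S x)%VL <-> (0 <= x)%VL) -> (forall y, exists x, S x = y) ->
  lattice_isomorphism S.
Proof.
move=> lS S0 surjS.
have SB x y : S (x - y) = S x - S y.
  by rewrite addrC -scaleN1r lS scaleN1r addrC.
have Sle x y : (S x <= S y)%VL <-> (x <= y)%VL.
  by rewrite -subv_ge0 -SB S0 subv_ge0.
have injS : injective S.
  by move=> x y xy; apply: vle_anti; apply/Sle; rewrite xy.
split; last first.
  have [g gK] := choice surjS.
  by exists g => // x; apply: injS; rewrite gK.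
split => // x y.
- have [z zE] := surjS (S x `|` S y)%VL; apply: vle_anti.
    by rewrite -zE; apply/Sle/vsupP; split; apply/Sle; rewrite zE;
      [exact: vsup_ubl|exact: vsup_ubr].
  by apply/vsupP; split; apply/Sle; [exact: vsup_ubl|exact: vsup_ubr].
- have [z zE] := surjS (S x `&` S y)%VL; apply: vle_anti.
    by apply/vinfP; split; apply/Sle; [exact: vinf_lbl|exact: vinf_lbr].
  by rewrite -zE; apply/Sle/vinfP; split; apply/Sle; rewrite zE;
    [exact: vinf_lbl|exact: vinf_lbr].
Qed.

Lemma order_dual_leP (phi psi : order_dual E) :
  (phi <= psi)%VL <-> forall x, (0 <= x)%VL -> phi x <= psi x.
Proof. by []. Qed.

Lemma order_dual_ge0P (phi : order_dual E) :
  (0 <= phi)%VL <-> forall x, (0 <= x)%VL -> 0 <= phi x.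
Proof. by rewrite order_dual_leP. Qed.

End VectorLattices.

(** * Functions and classes in L^p with support in some piece *)

Section CompactClass.
Context d (T : measurableType d) (R : realType) (mu : {measure set T -> \bar R}).
Context (Xi : exhaustion mu) (p : \bar R) (p1 : (1 <= p)%E).
Implicit Types f g : T -> R.
Local Notation L0 := {mfun_ mu, T >-> measurableTypeR R}.
Local Notation Lc := (Lspace_c Xi p1).

Definition compact_fun f : Prop :=
  [/\ measurable_fun [set: T] f, finite_norm mu p f &
      exists n, {ae mu, forall x, ~ Xi n x -> f x = 0}].

Lemma compact_class_subproof f (mf : measurable_fun [set: T] f) :
  finite_norm mu p f -> (ae_class mf : L0) \in Lspace_pred mu p.
Proof. by move=> nf; rewrite inE; exact: finite_norm_ae_class. Qed.

Lemma Lspace_c_ex f : compact_fun f ->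
  exists v : Lc, {ae mu, forall x, (v : L0) x = f x}.
Proof.
move=> [mf nf [n f0]].
have cf : Lspace_Sub p1 (compact_class_subproof mf nf) \in @Lspace_c_pred _ _ _ _ Xi _ p1.
  apply/asboolP; exists n; apply: filterS2 (ae_classE mf) f0.
  by move=> x /= -> /[apply].
by exists (LspaceC cf); exact: ae_classE.
Qed.

(** Made total by the value 0 outside [compact_fun], so that composing it with an element of the
    order dual gives a map on all functions, as [positive_functional] expects. *)
Definition compact_class f : Lc :=
  if pselect (compact_fun f) is left cf then sval (cid (Lspace_c_ex cf)) else 0.

Lemma ae_compact_classE f : compact_fun f ->
  {ae mu, forall x, (compact_class f : L0) x = f x}.
Proof. by rewrite /compact_class; case: pselect => // cf _; case: cid. Qed.

Lemma Lspace_cP (u v : Lc) : {ae mu, forall x, (u : L0) x = (v : L0) x} -> u = v.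
Proof. by move=> uv; apply/val_inj/val_inj/L0P. Qed.

Lemma ae_Lspace_cD (u v : Lc) :
  {ae mu, forall x, ((u + v : Lc) : L0) x = (u : L0) x + (v : L0) x}.
Proof. exact: (ae_addE (u : L0) (v : L0)). Qed.

Lemma ae_Lspace_cZ (a : R) (v : Lc) :
  {ae mu, forall x, ((a *: v : Lc) : L0) x = a * (v : L0) x}.
Proof. exact: (ae_scaleE a (v : L0)). Qed.

Lemma Lspace_c_le (u v : Lc) :
  (u <= v)%VL <-> {ae mu, forall x, (u : L0) x <= (v : L0) x}.
Proof. by []. Qed.

Lemma Lspace_c_ge0 (v : Lc) :
  (0 <= v)%VL <-> {ae mu, forall x, 0 <= (v : L0) x}.
Proof.
rewrite Lspace_c_le.
have z : {ae mu, forall x, ((0 : Lc) : L0) x = 0 :> R}.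
  exact: (ae_zeroE (mu := mu)).
by split; apply: filterS2 z => x ->.
Qed.

Lemma compact_fun_Lspace_c (v : Lc) : compact_fun (v : L0).
Proof.
split; [exact: measurable_L0|exact: Lspace_finite_norm|].
by have /asboolP[n v0] := valP v; exists n.
Qed.

Lemma compact_class_ae_eq f (v : Lc) : compact_fun f ->
  {ae mu, forall x, (v : L0) x = f x} -> compact_class f = v.
Proof.
move=> cf vf; apply: Lspace_cP.
by apply: filterS2 (ae_compact_classE cf) vf => x -> ->.
Qed.

End CompactClass.

(** * The integral pairing of the local L^q space with L^p_c *)

Section Pairing.
Context d (T : measurableType d) (R : realType) (mu : {measure set T -> \bar R}).
Context (Xi : exhaustion mu) (p q : \bar R) (p1 : (1 <= p)%E) (q1 : (1 <= q)%E).
Context (pq : (p^-1 + q^-1 = 1)%E).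
Local Notation L0 := {mfun_ mu, T >-> measurableTypeR R}.
Local Notation Lc := (Lspace_c Xi p1).
Local Notation Lloc := (Lspace_loc Xi q1).
Implicit Types (u : Lloc) (v w : Lc).

Let mX := exhaustion_measurable Xi.

Lemma measurable_pairing u v :
  measurable_fun [set: T] (EFin \o ((u : T -> R) \* ((v : L0) : T -> R))).
Proof.
by apply/measurable_EFinP; apply: measurable_funM; exact: measurable_L0.
Qed.

(** Since [v] vanishes off some [Xi n], [u] may be replaced by its product with the indicator of
    [Xi n], which is in L^q; then Hoelder applies. *)
Lemma pairing_integrable u v :
  mu.-integrable [set: T] (EFin \o ((u : T -> R) \* ((v : L0) : T -> R))).
Proof.
have [mv nv [n v0]] := compact_fun_Lspace_c v.
have mun : measurable_fun [set: T] ((u : T -> R) \* \1_(Xi n)).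
  by apply: measurable_funM; [exact: measurable_L0|exact: measurable_indic].
have nun : finite_norm mu q ((u : T -> R) \* \1_(Xi n)).
  apply: (finite_norm_extension (mD := mX n)) => //; first exact: measurable_L0.
  by have /Lspace_locP un := valP u; exact: un.
have qp : (q^-1 + p^-1 = 1)%E by rewrite addeC.
have /integrableP[_] := conjugate_integrable q1 p1 qp mun mv nun nv.
move=> uv; apply/integrableP; split; first exact: measurable_pairing.
apply: le_lt_trans uv; rewrite le_eqVlt; apply/orP; left; apply/eqP.
apply: ae_eq_integral => //.
- by apply: measurableT_comp => //; exact: measurable_pairing.
- by apply: measurableT_comp => //; apply/measurable_EFinP; exact: measurable_funM.
apply: filterS v0 => x v0 _ /=; rewrite indicE.
have [Xx|Xx] := pselect (Xi n x); first by rewrite mem_set// mulr1.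
by rewrite v0// !mulr0.
Qed.

Lemma pairing_subproof u :
  (fun v => \int[mu]_x ((u : T -> R) x * (v : L0) x)) \in order_dual_pred Lc.
Proof.
apply/order_dualP; split=> [a v w|v w].
  have uv := pairing_integrable u v; have uw := pairing_integrable u w.
  have auv : mu.-integrable [set: T] (EFin \o (fun x => a * ((u x : R) * (v : L0) x))).
    exact: (integrableZl measurableT a uv).
  rewrite -[RHS]/(a * _ + _) -RintegralZl// -RintegralD//.
  congr fine; apply: ae_eq_integral => //.
  - exact: measurable_pairing.
  - exact: (measurable_int mu (integrableD measurableT auv uw)).
  apply: filterS2 (ae_Lspace_cD (a *: v) w) (ae_Lspace_cZ a v) => x avw av _.
  by congr EFin; rewrite avw av mulrDr mulrCA.
have uv := integrable_norm (pairing_integrable u v).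
have uw := integrable_norm (pairing_integrable u w).
(* From [v <= z <= w] follows [|z| <= |v| + |w|]. *)
exists (\int[mu]_x (`|(u x : R) * (v : L0) x| + `|(u x : R) * (w : L0) x|)).
move=> z [/Lspace_c_le vz /Lspace_c_le zw].
have uz := pairing_integrable u z.
apply: le_trans (le_normr_Rintegral measurableT uz) _.
apply: fine_le; [| |].
- exact: (integrable_fin_num measurableT (integrable_norm uz)).
- exact: (integrable_fin_num measurableT (integrableD measurableT uv uw)).
apply: ae_ge0_le_integral => //.
- exact: (measurable_int mu (integrable_norm uz)).
- exact: (measurable_int mu (integrableD measurableT uv uw)).
apply: filterS2 vz zw => x vz zw _; rewrite lee_fin !normrM -mulrDr ler_wpM2l//.
rewrite ler_norml; apply/andP; split.
  have := ler_norm (- (v : L0) x : R); have := normr_ge0 ((w : L0) x : R).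
  by rewrite normrN; lra.
by have := ler_norm ((w : L0) x : R); have := normr_ge0 ((v : L0) x : R); lra.
Qed.

Definition pairing u : order_dual Lc := OrderDual (pairing_subproof u).

Lemma pairing_linear : linear pairing.
Proof.
move=> a u w; apply/val_inj/funext => v.
have uv := pairing_integrable u v; have wv := pairing_integrable w v.
have auv : mu.-integrable [set: T] (EFin \o (fun x => a * ((u x : R) * (v : L0) x))).
  exact: (integrableZl measurableT a uv).
rewrite -[RHS]/(a * _ + _) -[LHS]/(\int[mu]_x _) -RintegralZl// -RintegralD//.
congr fine; apply: ae_eq_integral => //.
- exact: measurable_pairing.
- exact: (measurable_int mu (integrableD measurableT auv wv)).
apply: filterS2 (ae_addE (a *: (u : L0)) (w : L0)) (ae_scaleE a (u : L0)).
move=> x /= auw au _; congr EFin.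
transitivity (((a *: (u : L0) : L0) x + (w : L0) x) * (v : L0) x : R).
  by congr (_ * _); exact: auw.
by rewrite au mulrDl mulrA.
Qed.

Lemma Lspace_loc_ge0 u : (0 <= u)%VL <-> {ae mu, forall x, 0 <= (u : L0) x :> R}.
Proof.
have z : {ae mu, forall x, (0 : L0) x = 0 :> R} by exact: ae_zeroE.
have -> : (0 <= u)%VL <-> {ae mu, forall x, (0 : L0) x <= (u : L0) x :> R} by [].
by split; apply: filterS2 z => x ->.
Qed.

Lemma pairing_ge0 u : (0 <= u)%VL -> (0 <= pairing u)%VL.
Proof.
move=> /Lspace_loc_ge0 u0; apply/order_dual_ge0P => v /Lspace_c_ge0 v0.
rewrite -[leRHS]/(fine (\int[mu]_x (u x * (v : L0) x)%:E)%E).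
(* The product is nonnegative only almost everywhere, so it is first replaced by its absolute
   value. *)
rewrite (ae_eq_integral (abse \o (EFin \o ((u : T -> R) \* ((v : L0) : T -> R)))))//.
- by apply: fine_ge0; apply: integral_ge0 => x _; exact: abse_ge0.
- exact: measurable_pairing.
- by apply: measurableT_comp => //; exact: measurable_pairing.
by apply: filterS2 u0 v0 => x u0 v0 _; rewrite /= ger0_norm// mulr_ge0.
Qed.

Lemma order_adjoint_pairing n u :
  order_adjoint (extension_positive Xi p1 n) (pairing u) =
  duality Xi p1 q1 pq n (restriction Xi q1 n u).
Proof.
apply/val_inj/funext => f.
rewrite -[LHS]/(\int[mu]_x (u x * (extension Xi p1 n f : L0) x)).
rewrite -[RHS]/(\int[mu]_(x in Xi n) (restriction Xi q1 n u x * f x)).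
congr fine; rewrite [RHS]integral_mkcond; apply: ae_eq_integral => //.
- exact: measurable_pairing.
- apply/(measurable_restrictT _ _).1 => //; apply: measurable_funTS.
  by apply/measurable_EFinP; apply: measurable_funM; exact: measurable_L0.
apply: filterS2 (ae_extensionE f) (ae_restrictionE n u) => x fx ux _.
rewrite patchE fx indicE; case: (boolP (x \in Xi n)); rewrite ?inE => Xx.
  by rewrite mulr1 -ux.
by rewrite !mulr0.
Qed.

End Pairing.

(** * The pairing reflects positivity *)

Section PairingSigmaFinite.
Context d (T : measurableType d) (R : realType)
  (mu : {sigma_finite_measure set T -> \bar R}).
Context (Xi : exhaustion mu) (r : R) (q : \bar R).
Context (r1 : (1 <= r%:E)%E) (q1 : (1 <= q)%E) (rq : (r%:E^-1 + q^-1 = 1)%E).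
Local Notation L0 := {mfun_ mu, T >-> measurableTypeR R}.
Local Notation Lc := (Lspace_c Xi r1).
Local Notation Lloc := (Lspace_loc Xi q1).

Let rR1 : 1 <= r. Proof. by have := r1; rewrite lee_fin. Qed.
Let mX := exhaustion_measurable Xi.
Let ndX : forall m n, (m <= n)%N -> Xi m `<=` Xi n.
Proof. exact: exhaustion_increasing. Qed.
Let cX := exhaustion_cover Xi.
Local Notation S := (pairing r1 rq).

Lemma pairing_ge0P (u : Lloc) : (0 <= S u)%VL <-> (0 <= u)%VL.
Proof.
split; last exact: pairing_ge0.
move=> /order_dual_ge0P Su0; apply/Lspace_loc_ge0.
have [Y [mY ndY YX Yoo cY]] := finite_measure_exhaustion mu mX ndX cX.
have mu_ : measurable_fun [set: T] (u : T -> R) by exact: measurable_L0.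
suff neg m : {ae mu, forall x, ~ (Y m `&` [set x | (u x : R) < 0]) x}.
  have := ae_foralln neg; apply: filterS => x negx.
  have [m _ Ym] : (\bigcup_n Y n) x by rewrite cY.
  by rewrite leNgt; apply/negP => ux; exact: (negx m).
set A := _ `&` _.
have mA : measurable A.
  apply: measurableI => //.
  rewrite (_ : [set x | _] = [set: T] `&` (u : T -> R) @^-1` `]-oo, 0[); first exact: mu_.
  by apply/seteqP; split => x /=; rewrite in_itv/=; [|case].
have Aoo : (mu A < +oo)%E.
  by apply: le_lt_trans (Yoo m); apply: le_measure; rewrite ?inE//; exact: subIsetl.
have cA : compact_fun Xi r%:E \1_A.
  split; first exact: measurable_indic.
    by apply/(finite_normE _ rR1); rewrite power_integral_indic.
  exists m; apply: aeW => x Xx; rewrite indicE memNset// => -[/YX].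
  by [].
pose v : Lc := compact_class Xi r1 \1_A.
have vE : {ae mu, forall x, (v : L0) x = \1_A x} by exact: ae_compact_classE.
have v0 : (0 <= v)%VL.
  by apply/Lspace_c_ge0; apply: filterS vE => x ->; rewrite indicE.
have iuv := pairing_integrable rq u v.
have muv := measurable_pairing u v.
(* As [v] is the indicator of a set where [u < 0], this integral is [- S u v], hence at most 0. So
   [u] vanishes almost everywhere on that set, which is therefore null. *)
have Iuv : (\int[mu]_x `|(u x * (v : L0) x)%:E| = 0)%E.
  apply/eqP; rewrite eq_le integral_ge0 ?andbT//.
  rewrite (ae_eq_integral (fun x => (-1)%:E * (u x * (v : L0) x)%:E)%E)//.
  - rewrite integralZl//.
    rewrite -(fineK (integrable_fin_num measurableT iuv)) -EFinM lee_fin mulN1r.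
    by rewrite oppr_le0; exact: Su0.
  - by apply: measurableT_comp.
  - exact: measurable_funeM.
  apply: filterS vE => x vx _; rewrite /= vx indicE.
  case: (boolP (x \in A)); rewrite ?inE => xA.
    by rewrite mulr1 ltr0_norm ?mulN1e//; case: xA.
  by rewrite mulr0 normr0 mule0.
have := (ae_eq_integral_abs mu measurableT muv).1 Iuv.
apply: filterS2 vE => x vx /(_ I)[]; rewrite vx => ux Ax.
by move: ux Ax.2; rewrite indicE mem_set// mulr1 /= => ->; rewrite ltxx.
Qed.

End PairingSigmaFinite.

(** * Every functional is a pairing *)

Section Surjectivity.
Context d (T : measurableType d) (R : realType)
  (mu : {sigma_finite_measure set T -> \bar R}).
Context (Xi : exhaustion mu) (r : R) (q : \bar R).
Context (r1 : (1 <= r%:E)%E) (q1 : (1 <= q)%E) (rq : (r%:E^-1 + q^-1 = 1)%E).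
Local Notation L0 := {mfun_ mu, T >-> measurableTypeR R}.
Local Notation Lc := (Lspace_c Xi r1).
Local Notation Lloc := (Lspace_loc Xi q1).

Let rR1 : 1 <= r. Proof. by have := r1; rewrite lee_fin. Qed.
Let mX := exhaustion_measurable Xi.
Let ndX : forall m n, (m <= n)%N -> Xi m `<=` Xi n.
Proof. exact: exhaustion_increasing. Qed.
Let cX := exhaustion_cover Xi.
Local Notation S := (pairing r1 rq : Lloc -> _).
Local Notation C := (supported_class mu r Xi).

(** The preimage is the class, for the measure restricted to [Xi n], of the same representative of
    [v], where [n] is such that [v] vanishes off [Xi n]. *)
Lemma extension_surjective (v : Lc) : exists n f, extension Xi r1 n f = v.
Proof.
have [mv /(finite_normE _ rR1) nv [n v0]] := compact_fun_Lspace_c v.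
have nvn : (ae_class mv : {mfun_ piece Xi n, T >-> measurableTypeR R})
    \in Lspace_pred (piece Xi n) r%:E.
  rewrite inE; apply: finite_norm_ae_class => //; apply/finite_normE => //.
  apply: le_lt_trans nv; rewrite /power_integral /piece.
  rewrite integral_mrestr; last exact: measurable_power.
  by apply: ge0_subset_integral => //; exact: measurable_power.
exists n, (Lspace_Sub r1 nvn); apply: Lspace_cP.
have vn : {ae mu, forall x, Xi n x -> Lspace_Sub r1 nvn x = (v : L0) x}.
  apply/(ae_mrestr mu (mX n)); exact: (ae_classE (mu := piece Xi n) mv).
apply: filterS3 (ae_extensionE (Lspace_Sub r1 nvn)) vn v0 => x -> vn v0.
rewrite indicE; case: (boolP (x \in Xi n)) => [|/negP]; rewrite inE => Xx.
  by rewrite mulr1 vn.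
by rewrite mulr0 v0.
Qed.

Lemma supported_compact n f : C n f -> compact_fun Xi r%:E f.
Proof. by move=> [mf /(finite_normE _ rR1) If f0]; split => //; exists n. Qed.

Lemma order_dual_positive_functional (phi : order_dual Lc) : (0 <= phi)%VL ->
  positive_functional mu r Xi (fun f => phi (compact_class Xi r1 f)).
Proof.
move=> /order_dual_ge0P phi0; split => [n f g Cf Cg|n a f Cf|n f g Cf Cg fg].
- rewrite -raddfD; congr (phi _); apply: compact_class_ae_eq.
    exact: supported_compact (supported_classD rR1 Cf Cg).
  apply: filterS3 (ae_Lspace_cD (compact_class Xi r1 f) (compact_class Xi r1 g))
    (ae_compact_classE r1 (supported_compact Cf))
    (ae_compact_classE r1 (supported_compact Cg)).
  by move=> x -> -> ->.
- rewrite -linearZ; congr (phi _); apply: compact_class_ae_eq.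
    exact: supported_compact (supported_classZ a Cf).
  apply: filterS2 (ae_Lspace_cZ a (compact_class Xi r1 f))
    (ae_compact_classE r1 (supported_compact Cf)).
  by move=> x -> ->.
- rewrite -subr_ge0 -raddfB; apply: phi0; apply/subv_ge0/Lspace_c_le.
  apply: filterS3 fg (ae_compact_classE r1 (supported_compact Cf))
    (ae_compact_classE r1 (supported_compact Cg)).
  by move=> x fg -> ->.
Qed.

Lemma pairing_surjective_positive (phi : order_dual Lc) : (0 <= phi)%VL ->
  exists u, S u = phi.
Proof.
move=> phi0; have Phi_pos := order_dual_positive_functional phi0.
have [u [mu_ u0 uE]] := positive_functional_real_density rR1 mX ndX cX Phi_pos.
have lu : (ae_class mu_ : L0) \in Lspace_loc_pred Xi q1.
  apply/Lspace_locP => n.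
  have un := density_finite_norm rR1 mX ndX cX Phi_pos mu_ u0 uE n q1 rq.
  apply: (finite_norm_le q1 (measurable_L0 _) mu_ _ un).
  by apply/ae_mrestr; apply: filterS (ae_classE mu_) => x ->.
exists (LspaceLoc lu); apply/val_inj/funext => v.
(* Positive elements suffice, as every [v] is the difference of its positive and negative parts. *)
suff SE w : (0 <= w)%VL -> S (LspaceLoc lu) w = phi w.
  rewrite [v]vpos_vneg.
  transitivity (S (LspaceLoc lu) (vpos v) - S (LspaceLoc lu) (vneg v)).
    exact: raddfB.
  rewrite !SE//; exact/esym/raddfB.
move=> /Lspace_c_ge0 w0.
have [mw nw [n wn]] := compact_fun_Lspace_c w.
(* The density formula asks for pointwise nonnegativity, while the representative of [w] has it only
   almost everywhere. *)
pose f x := `|(w : L0) x : R|.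
have mf : measurable_fun [set: T] f by exact: measurableT_comp.
have Cf : C n f.
  apply: (@supported_class_le _ _ _ _ _ rR1 _ _ _ (w : L0)) => //.
    by split => //; apply/(finite_normE _ rR1).
  by apply: aeW => x; rewrite /f normr_id.
have fw : compact_class Xi r1 f = w.
  apply: compact_class_ae_eq; first exact: supported_compact Cf.
  by apply: filterS w0 => x w0; rewrite /f ger0_norm.
have := uE _ _ Cf (fun x => normr_ge0 _); rewrite fw => phiE.
rewrite -[RHS]/(fine (phi w)%:E) phiE; congr fine; apply: ae_eq_integral => //.
- exact: measurable_pairing.
- by apply/measurable_EFinP; exact: measurable_funM.
apply: filterS2 w0 (ae_classE mu_) => x w0 ux _; rewrite /= ux /f ger0_norm//.
by rewrite mulrC.
Qed.

Lemma pairing_surjective (phi : order_dual Lc) : exists u, S u = phi.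
Proof.
have [u uE] := pairing_surjective_positive (vpos_ge0 phi).
have [w wE] := pairing_surjective_positive (vneg_ge0 phi).
exists (u - w); rewrite [phi]vpos_vneg -uE -wE addrC -scaleN1r.
by rewrite pairing_linear scaleN1r addrC.
Qed.

Lemma pairing_lattice_isomorphism : lattice_isomorphism S.
Proof.
apply: lattice_isomorphism_of_order_embedding.
- exact: pairing_linear.
- exact: pairing_ge0P.
- exact: pairing_surjective.
Qed.

End Surjectivity.

Theorem theorem6p3 (d : measure_display) (X : measurableType d) (R : realType)
    (mu : {sigma_finite_measure set X -> \bar R})
    (mu_complete : measure_is_complete mu)
    (Xi : exhaustion mu)
    (p q : \bar R) (p_ge1 : (1 <= p)%E) (p_lty : (p < +oo)%E)
    (q_ge1 : (1 <= q)%E) (pq : (p^-1 + q^-1)%E = 1%E) :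
  exists! S : Lspace_loc Xi q_ge1 -> order_dual (Lspace_c Xi p_ge1),
    lattice_isomorphism S /\
    forall n : nat,
      order_adjoint (extension_positive Xi p_ge1 n) \o S =
      duality Xi p_ge1 q_ge1 pq n \o restriction Xi q_ge1 n.
Proof.
case: p p_ge1 p_lty pq => [r| |]// r1 _ rq.
exists (pairing r1 rq); split.
  split; first exact: pairing_lattice_isomorphism.
  by move=> n; apply/funext => u; exact: order_adjoint_pairing.
(* Uniqueness: [v] is the extension of some [f] on [Xi n], so the condition at that [n] determines
   the value of [S u] at [v]. *)
move=> S [_ SE]; apply/funext => u; apply/val_inj/funext => v.
have [n [f <-]] := extension_surjective v.
rewrite -[LHS]/(order_adjoint (extension_positive Xi r1 n) (pairing r1 rq u) f).
rewrite -[RHS]/((order_adjoint (extension_positive Xi r1 n) \o S) u f).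
by rewrite SE order_adjoint_pairing.
Qed.
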